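(* Let $H$ be a separable Hilbert space, $q\in\mathbb{N}$, $1\le p<\infty$, $R,T\in\mathcal{L}(H)$ and $D_1,D_2\subset H$. Let $D_1$ and $D_2$ both span dense subspaces of $H$. Suppose that for each $(x,y)\in D_1\times D_2$ there exist sequences $(x_n)_{n\ge0}$ and $(y_n)_{n\ge0}$ in $H$ with $(x_0,y_0)=(x,y)$ and (a) $\sum_{n=1}^{r}\|R^{r^q-(r-n)^q}(x)\|^p\,\|(T^* )^{r^q-(r-n)^q}(y)\|^p<\infty$ and $\sum_{n=1}^{\infty}\|x_{(n+r)^q-r^q}\|^p\,\|y_{(n+r)^q-r^q}\|^p<\infty$, uniformly in $r\ge0$; (b) $\langle R^{n}(x),R^{m}(x)\rangle=\langle x_n,x_m\rangle=\langle (T^* )^{n}(y),(T^* )^{m}(y)\rangle=\langle y_n,y_m\rangle=0$ for $m\ne n$; and (c) $R^{n^q}x_{n^q}=x$, $(T^* )^{n^q}y_{n^q}=y$, $R^{n^q}x_{m^q}=x_{m^q-n^q}$ and $(T^* )^{n^q}y_{m^q}=y_{m^q-n^q}$ for all $m>n\ge0$. Then $C_{R,T}$ is $q$-frequently hypercyclic on $(S_p(H),\|\cdot\|_p)$.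
   Context: $C_{R,T}$ is the map $C_{R,T}(S)=RST$. $S_p(H)$ is the Schatten–von Neumann class of all $S\in\mathcal{L}(H)$ whose approximation numbers $a_n(S)=\inf\{\|S-F\|:\ \mathrm{rank}(F)<n\}$, $n\ge1$, form a sequence in $\ell^p$, with norm $\|S\|_p=\|(a_n(S))\|_{\ell^p}$. A continuous linear operator $A$ on a topological vector space $E$ is $q$-frequently hypercyclic if there is $x\in E$ such that for every non-empty open $V\subset E$ the set $M=\{n\in\mathbb{N}: A^nx\in V\}$ satisfies $\liminf_{N\to\infty}\frac{\mathrm{card}\{n\in M:\ n\le N^q\}}{N}>0$. In (a), ''$<\infty$ uniformly in $r$'' means that the series of non-negative terms converge uniformly in $r$: for every $\varepsilon>0$ there is $N$ such that, for every $r\ge0$, the sum of the terms with index $n\ge N$ (and $n\le r$ for the first series) is less than $\varepsilon$. *)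

(* Defs.v *)
From HB Require Import structures.
From mathcomp Require Import all_boot all_order all_algebra.
From mathcomp Require Import complex.
From mathcomp Require Import all_classical all_reals all_analysis.
Set Implicit Arguments.
Unset Strict Implicit.
Unset Printing Implicit Defensive.
Import Order.TTheory GRing.Theory Num.Theory.
Import numFieldNormedType.Exports.
Local Open Scope classical_set_scope.
Local Open Scope ring_scope.

Variant scalar_kind := RealScalars | ComplexScalars.

Definition scalars (R : realType) (k : scalar_kind) : numFieldType :=
  match k with
  | RealScalars => R
  | ComplexScalars => R[i]
  end.

Definition scalar_conj (R : realType) (k : scalar_kind) :
    scalars R k -> scalars R k :=
  match k with
  | RealScalars => fun a => a
  | ComplexScalars => @conjc R
  end.

Definition scalar_re (R : realType) (k : scalar_kind) : scalars R k -> R :=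
  match k with
  | RealScalars => fun a => a
  | ComplexScalars => @complex.Re R
  end.

(* inner is linear in its first argument and conjugate-linear in the second. *)
HB.mixin Record CompleteNormedModule_isHilbert (R : realType) (k : scalar_kind)
    H & CompleteNormedModule (scalars R k) H := {
  inner : {dot H for @scalar_conj R k} ;
  innerxx : forall x : H, inner x x = `|x| ^+ 2
}.

#[short(type="hilbertType")]
HB.structure Definition Hilbert (R : realType) (k : scalar_kind) :=
  {H of CompleteNormedModule (scalars R k) H
      & CompleteNormedModule_isHilbert R k H}.


Section Scalars.
Context (R : realType) (k : scalar_kind).

Definition scalar_of : R -> scalars R k :=
  match k return R -> scalars R k with
  | RealScalars => fun r => r
  | ComplexScalars => fun r => r%:C%C
  end.

Local Notation re := (@scalar_re R k).

Lemma scalar_ofK : cancel scalar_of re.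
Proof. by rewrite /scalar_of /scalar_re; case: k. Qed.

Lemma scalar_reD a b : re (a + b) = re a + re b.
Proof.
by move: a b; rewrite /scalar_re /scalars; case: k => //= -[? ?] [? ?].
Qed.

Lemma scalar_reM r a : re (scalar_of r * a) = r * re a.
Proof.
move: a; rewrite /scalar_re /scalar_of /scalars; case: k => //= -[? ?] /=.
by rewrite mul0r subr0.
Qed.

Lemma scalar_re_le a b : a <= b -> re a <= re b.
Proof.
move: a b; rewrite /scalar_re /scalars; case: k => //= a b.
by rewrite lecE => /andP[].
Qed.

Lemma scalar_re_lt a b : a < b -> re a < re b.
Proof.
move: a b; rewrite /scalar_re /scalars; case: k => //= a b.
by rewrite ltcE => /andP[].
Qed.

Lemma ge0_scalar_reK a : 0 <= a -> scalar_of (re a) = a.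
Proof.
move: a; rewrite /scalar_re /scalar_of /scalars; case: k => //= -[x y] /=.
by rewrite lecE /= => /andP[/eqP -> _].
Qed.

Lemma scalar_of0 : scalar_of 0 = 0.
Proof. by rewrite /scalar_of /scalars; case: k. Qed.

Lemma scalar_re0 : re 0 = 0.
Proof. by rewrite -scalar_of0 scalar_ofK. Qed.

Lemma scalar_of_le r s : (scalar_of r <= scalar_of s) = (r <= s).
Proof. by rewrite /scalar_of /scalars; case: k => //=; rewrite lecR. Qed.

Lemma scalar_of_lt r s : (scalar_of r < scalar_of s) = (r < s).
Proof. by rewrite /scalar_of /scalars; case: k => //=; rewrite ltcR. Qed.
End Scalars.

Section RealNorm.
Context (R : realType) (k : scalar_kind).

(* In a module over the complexes, `|x| is itself a complex number; rnorm x is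
   the same norm as a real number. *)
Definition rnorm (V : normedZmodType (scalars R k)) (x : V) : R := scalar_re `|x|.

Section Zmod.
Context (V : normedZmodType (scalars R k)).
Implicit Types x y : V.

Lemma rnormE x : `|x| = scalar_of k (rnorm x).
Proof. by rewrite ge0_scalar_reK. Qed.

Lemma rnorm_ge0 x : 0 <= rnorm x.
Proof. by rewrite -(scalar_re0 R k); apply/scalar_re_le/normr_ge0. Qed.

Lemma rnormD x y : rnorm (x + y) <= rnorm x + rnorm y.
Proof. by rewrite -scalar_reD; apply/scalar_re_le/ler_normD. Qed.

Lemma rnormN x : rnorm (- x) = rnorm x.
Proof. by rewrite /rnorm normrN. Qed.

Lemma rnorm0 : rnorm (0 : V) = 0.
Proof. by rewrite /rnorm normr0 scalar_re0. Qed.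

Lemma rnorm_eq0 x : rnorm x = 0 -> x = 0.
Proof. by move=> h; apply/normr0_eq0; rewrite rnormE h scalar_of0. Qed.

Lemma lt_rnorm x r : (`|x| < scalar_of k r) = (rnorm x < r).
Proof. by rewrite rnormE scalar_of_lt. Qed.
End Zmod.

Lemma rnormZ (V : normedModType (scalars R k)) a (x : V) :
  rnorm (a *: x) = rnorm (a : scalars R k) * rnorm x.
Proof. by rewrite {1}/rnorm normrZ [X in X * _]rnormE scalar_reM. Qed.

Lemma rnorm_scalar_of r : rnorm (scalar_of k r) = `|r|.
Proof.
rewrite /rnorm /scalar_of /scalar_re /scalars; case: k => //=.
by rewrite expr0n /= addr0 sqrtr_sqr.
Qed.
End RealNorm.

Section ContLinear.
Context (K : numFieldType) (E F : topologicalLmodType K).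

Definition clinear_pred : {pred (E -> F)} :=
  mem [set f : E -> F | linear f /\ continuous f].

Record clinear := CLinear {
  clinear_fun :> E -> F ;
  _ : clinear_fun \in clinear_pred }.

HB.instance Definition _ := [isSub for clinear_fun].
HB.instance Definition _ := [Choice of clinear by <:].

Fact clinear_submod_closed : submod_closed clinear_pred.
Proof.
split=> [|a f g]; rewrite !inE.
  split=> [a u v|]; first by rewrite scaler0 addr0.
  exact: cst_continuous.
move=> [fl fc] [gl gc]; split=> [b u v|x].
  rewrite !fctE fl gl; rewrite !scalerDr !scalerA [b * a]mulrC.
  by rewrite !addrA; congr (_ + _); rewrite -!addrA; congr (_ + _); rewrite addrC.
apply: (@continuous_comp _ (F * F)%type _ (fun x => (a *: f x, g x))
   (fun z => z.1 + z.2)); last exact: add_continuous.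
apply: cvg_pair => /=; last exact: gc.
apply: (@continuous_comp _ (K^o * F)%type _ (fun x => (a, f x))
   (fun z => z.1 *: z.2)); last exact: scale_continuous.
by apply: (@cvg_pair _ _ _ _ (nbhs (a : K^o))); [exact: cvg_cst|exact: fc].
Qed.

HB.instance Definition _ :=
  GRing.isSubmodClosed.Build K (E -> F) clinear_pred clinear_submod_closed.
HB.instance Definition _ := [SubChoice_isSubLmodule of clinear by <:].

Fact clinear_linear (f : clinear) : linear f.
Proof. by case: f => f /=; rewrite inE => -[]. Qed.

HB.instance Definition _ (f : clinear) :=
  GRing.isLinear.Build K E F *:%R (clinear_fun f) (clinear_linear f).

Lemma clinear_continuous (f : clinear) : continuous f.
Proof. by case: f => f /=; rewrite inE => -[]. Qed.

Lemma clinearP (f g : clinear) : f =1 g -> f = g.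
Proof. by move=> fg; apply/val_inj/funext. Qed.

Definition mk_clinear (f : E -> F) (fl : linear f) (fc : continuous f) :=
  CLinear (mem_set (conj fl fc) : f \in clinear_pred).
End ContLinear.

Section ContLinearOps.
Context (K : numFieldType) (E F G : topologicalLmodType K).

Fact clinear_comp_linear (f : clinear F G) (g : clinear E F) : linear (f \o g).
Proof. by move=> a x y; rewrite /= !linearP. Qed.

Fact clinear_comp_continuous (f : clinear F G) (g : clinear E F) :
  continuous (f \o g).
Proof. by move=> x; apply: continuous_comp; exact: clinear_continuous. Qed.

Definition clinear_comp (f : clinear F G) (g : clinear E F) : clinear E G :=
  mk_clinear (@clinear_comp_linear f g) (@clinear_comp_continuous f g).

End ContLinearOps.

HB.lock Definition op_norm (R : realType) (k : scalar_kind)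
    (E F : normedModType (scalars R k)) (S : clinear E F) : R :=
  sup [set rnorm (S x) | x in [set x | rnorm x <= 1]].
Canonical op_norm_unlockable := Unlockable op_norm.unlock.

Section OperatorNorm.
Context (R : realType) (k : scalar_kind).
Implicit Types E F G : normedModType (scalars R k).

Lemma clinear_bounded E F (S : clinear E F) :
  exists2 M, 0 <= M & forall x, rnorm (S x) <= M * rnorm x.
Proof.
have /linear_boundedP/pinfty_ex_gt0[r r0 Sr] : bounded_near S (nbhs (0 : E)).
  exact/continuous_linear_bounded/clinear_continuous.
exists (scalar_re r).
  by rewrite -(scalar_re0 R k); apply/scalar_re_le/ltW.
move=> x; rewrite -scalar_reM ge0_scalar_reK; last exact: ltW.
exact/scalar_re_le/Sr.
Qed.

Lemma op_norm_has_sup E F (S : clinear E F) :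
  has_sup [set rnorm (S x) | x in [set x | rnorm x <= 1]].
Proof.
split; first by exists (rnorm (S 0)), 0 => //=; rewrite rnorm0.
have [M M0 SM] := clinear_bounded S.
exists M => _ [x /= x1 <-]; apply: (le_trans (SM x)).
by rewrite -[leRHS]mulr1 ler_wpM2l.
Qed.

Lemma op_norm_ge0 E F (S : clinear E F) : 0 <= op_norm S.
Proof.
apply: (@le_trans _ _ (rnorm (S 0))); first exact: rnorm_ge0.
rewrite unlock; apply: sup_upper_bound; first exact: op_norm_has_sup.
by exists 0 => //=; rewrite rnorm0.
Qed.

Lemma op_normP E F (S : clinear E F) x : rnorm (S x) <= op_norm S * rnorm x.
Proof.
have [x0|x0] := eqVneq (rnorm x) 0.
  by rewrite (rnorm_eq0 x0) linear0 !rnorm0 mulr0.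
have xgt0 : 0 < rnorm x by rewrite lt_neqAle eq_sym x0 rnorm_ge0.
rewrite -ler_pdivrMr// mulrC -[(rnorm x)^-1]gtr0_norm ?invr_gt0//.
rewrite -(rnorm_scalar_of k) -rnormZ -linearZ.
rewrite unlock; apply: sup_upper_bound; first exact: op_norm_has_sup.
exists (scalar_of k (rnorm x)^-1 *: x) => //=.
by rewrite rnormZ rnorm_scalar_of gtr0_norm ?invr_gt0// mulVf.
Qed.

Lemma op_norm_le E F (S : clinear E F) M : 0 <= M ->
  (forall x, rnorm (S x) <= M * rnorm x) -> op_norm S <= M.
Proof.
move=> M0 SM; rewrite unlock; apply: ge_sup; first by have [] := op_norm_has_sup S.
move=> _ [x /= x1 <-]; apply: (le_trans (SM x)).
by rewrite -[leRHS]mulr1 ler_wpM2l.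
Qed.

Lemma op_normD E F (S T : clinear E F) : op_norm (S + T) <= op_norm S + op_norm T.
Proof.
apply: op_norm_le => [|x]; first by rewrite addr_ge0 ?op_norm_ge0.
by rewrite mulrDl (le_trans (rnormD _ _))// lerD ?op_normP.
Qed.

Lemma op_normZ E F a (S : clinear E F) :
  op_norm (a *: S) <= rnorm (a : scalars R k) * op_norm S.
Proof.
apply: op_norm_le => [|x]; first by rewrite mulr_ge0 ?rnorm_ge0 ?op_norm_ge0.
by rewrite -[(_ *: S) x]/(a *: S x) rnormZ -mulrA ler_wpM2l ?rnorm_ge0 ?op_normP.
Qed.

Lemma op_norm_comp E F G (S : clinear F G) (T : clinear E F) :
  op_norm (clinear_comp S T) <= op_norm S * op_norm T.
Proof.
apply: op_norm_le => [|x]; first by rewrite mulr_ge0 ?op_norm_ge0.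
apply: (le_trans (op_normP S (T x))); rewrite -mulrA.
exact: ler_wpM2l (op_norm_ge0 _) _ _ (op_normP _ _).
Qed.

End OperatorNorm.

Section Rank.
Context (K : numFieldType).

Definition lin_span (E : lmodType K) (D : set E) : set E :=
  [set x | exists n (c : 'I_n -> K) (v : 'I_n -> E),
     (forall i, D (v i)) /\ x = \sum_i c i *: v i].

Definition lin_indep (E : lmodType K) n (v : 'I_n -> E) :=
  forall c : 'I_n -> K, \sum_i c i *: v i = 0 -> forall i, c i = 0.

Definition has_dim (E : lmodType K) (W : set E) (n : nat) :=
  exists v : 'I_n -> E, lin_indep v /\ lin_span (range v) = W.

Definition rank_lt (E F : topologicalLmodType K) (A : clinear E F) (n : nat) :=
  exists2 d, (d < n)%N & has_dim (range A) d.

Lemma lin_span_range (E : lmodType K) n (v : 'I_n -> E) :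
  lin_span (range v) = [set x | exists c : 'I_n -> K, x = \sum_i c i *: v i].
Proof.
apply/seteqP; split=> x /=; last first.
  by move=> [c ->]; exists n, c, v; split=> // i; exists i.
move=> [m [c [w [vw ->]]]].
have /choice[f fE] : forall i, exists j, v j = w i.
  by move=> i; have [j _ <-] := vw i; exists j.
exists (fun j => \sum_(i | f i == j) c i).
rewrite (partition_big f xpredT) //=; apply: eq_bigr => j _.
by rewrite scaler_suml; apply: eq_bigr => i /eqP <-; rewrite fE.
Qed.

Lemma lin_indep_size (E : lmodType K) m n (u : 'I_m -> E) (v : 'I_n -> E) :
  lin_indep u -> (forall i, exists c : 'I_n -> K, u i = \sum_j c j *: v j) ->
  (m <= n)%N.
Proof.
move=> ui /choice[c uc]; rewrite leqNgt; apply/negP => nm.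
pose A := \matrix_(i < m, j < n) c i j.
have : kermx A != 0.
  rewrite -mxrank_eq0 mxrank_ker subn_eq0 -ltnNge.
  exact: leq_ltn_trans (rank_leq_col A) nm.
move=> /eqP; apply; apply/matrixP => l i; rewrite [RHS]mxE.
apply: (ui (fun i => kermx A l i)) => /=.
under eq_bigr do rewrite uc scaler_sumr.
rewrite exchange_big /= big1// => j _.
under eq_bigr do rewrite scalerA.
rewrite -scaler_suml.
have /matrixP/(_ l j) := mulmx_ker A; rewrite [LHS]mxE [RHS]mxE => kA.
suff -> : \sum_(i < m) kermx A l i * c i j = 0 by rewrite scale0r.
apply: etrans kA; apply: eq_bigr => h _.
by rewrite [A _ _]mxE.
Qed.

Lemma has_dim_gen (E : lmodType K) (W : set E) n (v : 'I_n -> E) :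
  W 0 -> (forall a x y, W x -> W y -> W (a *: x + y)) ->
  (forall x, W x -> exists c : 'I_n -> K, x = \sum_j c j *: v j) ->
  exists2 d, (d <= n)%N & has_dim W d.
Proof.
move=> W0 WD Wv.
pose P d := `[< exists u : 'I_d -> E, lin_indep u /\ forall i, W (u i) >].
have P0 : exists d, P d.
  exists 0; apply/asboolP; exists (fun=> 0); split; last by case.
  by move=> ? _ [].
have Pn d : P d -> (d <= n)%N.
  by move=> /asboolP[u [ui Wu]]; apply: lin_indep_size ui _ => i; exact/Wv/Wu.
case: (ex_maxnP P0 Pn) => d /asboolP[u [ui Wu]] dmax.
exists d; first by apply: Pn; apply/asboolP; exists u.
exists u; split=> //; rewrite lin_span_range; apply/seteqP; split=> x /=.
  move=> [c ->]; elim/big_ind : _ => // [y z Wy Wz|i _].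
    by rewrite -[y]scale1r; exact: WD.
  by rewrite -[X in W X]addr0; exact: WD.
move=> Wx; apply: contrapT => xu.
suff : P d.+1 by move=> /dmax; rewrite ltnn.
pose w (i : 'I_d.+1) := if unlift ord0 i is Some j then u j else x.
apply/asboolP; exists w; split; last by move=> i; rewrite /w; case: unliftP.
move=> c; rewrite big_ord_recl {1}/w unlift_none.
under eq_bigr do rewrite /w liftK.
move=> cx; have c0 : c ord0 = 0.
  apply/eqP/negP => /negP c0; apply: xu.
  exists (fun i => - (c ord0)^-1 * c (lift ord0 i)).
  under eq_bigr do rewrite -scalerA.
  rewrite -scaler_sumr; apply: (scalerI c0).
  rewrite scalerA mulrN mulfV// scaleN1r; apply/eqP.
  by rewrite -subr_eq0 opprK; apply/eqP.
move: cx; rewrite c0 scale0r add0r => /ui cx i.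
by case: (unliftP ord0 i) => [j ->|->//]; exact: cx.
Qed.

Lemma rank_ltP (E F : topologicalLmodType K) (A : clinear E F) n :
  rank_lt A n <-> exists2 d, (d < n)%N &
    exists v : 'I_d -> F, forall x, exists c : 'I_d -> K, A x = \sum_i c i *: v i.
Proof.
split=> [[d dn [v [_]]]|[d dn [v Av]]].
  rewrite lin_span_range => vA; exists d => //; exists v => x.
  by have : range A (A x) by []; rewrite -vA.
have [] := @has_dim_gen F (range A) d v.
- by exists 0 => //; rewrite linear0.
- by move=> a _ _ [x _ <-] [y _ <-]; exists (a *: x + y) => //; rewrite linearP.
- by move=> _ [x _ <-]; exact: Av.
by move=> m md Am; exists m => //; exact: leq_ltn_trans dn.
Qed.

Lemma rank_lt0 (E F : topologicalLmodType K) n : rank_lt (0 : clinear E F) n.+1.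
Proof.
apply/rank_ltP; exists 0 => //; exists (fun=> 0) => x; exists (fun=> 0).
by rewrite big_ord0.
Qed.

Lemma rank_ltZ (E F : topologicalLmodType K) a (A : clinear E F) n :
  rank_lt A n -> rank_lt (a *: A) n.
Proof.
move=> /rank_ltP[d dn [v /choice[c Ac]]]; apply/rank_ltP; exists d => //.
exists v => x; exists (fun i => a * c x i).
under eq_bigr do rewrite -scalerA.
by rewrite -scaler_sumr -Ac.
Qed.

Lemma rank_ltD (E F : topologicalLmodType K) (A B : clinear E F) m n :
  rank_lt A m.+1 -> rank_lt B n.+1 -> rank_lt (A + B) (m + n).+1.
Proof.
move=> /rank_ltP[d dm [v /choice[c Ac]]] /rank_ltP[e en [w /choice[b Bb]]].
apply/rank_ltP; exists (d + e)%N; first by rewrite ltnS leq_add.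
exists (fun i : 'I_(d + e) => match fintype.split i with inl j => v j | inr j => w j end) => x.
exists (fun i : 'I_(d + e) => match fintype.split i with inl j => c x j | inr j => b x j end).
rewrite big_split_ord /=.
rewrite [LHS](_ : _ = A x + B x)// Ac Bb; congr (_ + _); apply: eq_bigr => i _.
  by rewrite (unsplitK (inl i)).
by rewrite (unsplitK (inr i)).
Qed.

Lemma rank_lt_comp (E F G H : topologicalLmodType K)
    (S : clinear G H) (A : clinear F G) (T : clinear E F) n :
  rank_lt A n -> rank_lt (clinear_comp S (clinear_comp A T)) n.
Proof.
move=> /rank_ltP[d dn [v /choice[c Ac]]]; apply/rank_ltP; exists d => //.
exists (fun i => S (v i)) => x; exists (c (T x)).
rewrite /= Ac linear_sum; apply: eq_bigr => i _.
by rewrite linearZ.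
Qed.

End Rank.

HB.lock Definition approx_number (R : realType) (k : scalar_kind)
    (E F : normedModType (scalars R k)) (n : nat) (S : clinear E F) : R :=
  inf [set op_norm (S - A) | A in [set A | rank_lt A n]].
Canonical approx_number_unlockable := Unlockable approx_number.unlock.

Section ApproximationNumbers.
Context (R : realType) (k : scalar_kind).
Implicit Types E F : normedModType (scalars R k).

Lemma approx_number_has_inf E F n (S : clinear E F) :
  has_inf [set op_norm (S - A) | A in [set A | rank_lt A n.+1]].
Proof.
split; first by exists (op_norm (S - 0)), 0 => //; exact: rank_lt0.
by exists 0 => _ [A _ <-]; exact: op_norm_ge0.
Qed.

Lemma approx_number_ge0 E F n (S : clinear E F) : 0 <= approx_number n.+1 S.
Proof.
rewrite unlock; apply: lb_le_inf; first by have [] := approx_number_has_inf n S.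
by move=> _ [A _ <-]; exact: op_norm_ge0.
Qed.

Lemma approx_number_le E F n (S A : clinear E F) :
  rank_lt A n.+1 -> approx_number n.+1 S <= op_norm (S - A).
Proof.
move=> An; rewrite unlock; apply: ge_inf; last by exists A.
by have [] := approx_number_has_inf n S.
Qed.

Lemma le_approx_number E F n (S : clinear E F) M :
  (forall A, rank_lt A n.+1 -> M <= op_norm (S - A)) -> M <= approx_number n.+1 S.
Proof.
move=> h; rewrite unlock; apply: lb_le_inf; first by have [] := approx_number_has_inf n S.
by move=> _ [A An <-]; exact: h.
Qed.

Lemma approx_numberD E F m n (S T : clinear E F) :
  approx_number (m + n).+1 (S + T) <= approx_number m.+1 S + approx_number n.+1 T.
Proof.
rewrite -lerBlDr; apply: le_approx_number => A Am.
rewrite lerBlDr -lerBlDl; apply: le_approx_number => B Bn.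
rewrite lerBlDl; apply: le_trans (approx_number_le _ (rank_ltD Am Bn)) _.
by apply: le_trans (op_normD _ _); rewrite opprD addrACA.
Qed.

Lemma approx_number_scale E F n M (S S' : clinear E F) : 0 <= M ->
  (forall A, rank_lt A n.+1 -> exists2 B, rank_lt B n.+1 &
     op_norm (S' - B) <= M * op_norm (S - A)) ->
  approx_number n.+1 S' <= M * approx_number n.+1 S.
Proof.
rewrite le_eqVlt => /predU1P[<-|M0] h.
  have [B Bn] := h _ (rank_lt0 E F n); rewrite !mul0r; apply: le_trans.
  exact: approx_number_le.
rewrite -ler_pdivrMl//; apply: le_approx_number => A /h[B Bn SB].
by rewrite ler_pdivrMl//; apply: le_trans SB; exact: approx_number_le.
Qed.

Lemma approx_numberZ E F n a (S : clinear E F) :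
  approx_number n.+1 (a *: S) <= rnorm (a : scalars R k) * approx_number n.+1 S.
Proof.
apply: approx_number_scale; first exact: rnorm_ge0.
move=> A An; exists (a *: A); first exact: rank_ltZ.
by rewrite -scalerBr; exact: op_normZ.
Qed.

Lemma approx_number_mono E F m n (S : clinear E F) : (m <= n)%N ->
  approx_number n.+1 S <= approx_number m.+1 S.
Proof.
move=> mn; apply: le_approx_number => A [d dn Ad]; apply: approx_number_le.
by exists d => //; exact: leq_trans dn _.
Qed.

End ApproximationNumbers.

Lemma powRD_le (R : realType) (p a b : R) : 0 < p -> 0 <= a -> 0 <= b ->
  (a + b) `^ p <= 2 `^ p * (a `^ p + b `^ p).
Proof.
move=> p0 a0 b0; wlog ab : a b a0 b0 / a <= b.
  by move=> h; case: (leP a b) => [/h|/ltW/h]; [|rewrite addrC [_ `^ p + _]addrC]; exact.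
apply: (@le_trans _ _ ((2 * b) `^ p)).
  apply: ge0_ler_powR; rewrite ?nnegrE ?addr_ge0 ?mulr_ge0//; first exact: ltW.
  by rewrite mulr2n mulrDl mul1r lerD2r.
by rewrite powRM// ler_wpM2l ?powR_ge0// lerDr powR_ge0.
Qed.

Section SchattenNorm.
Context (R : realType) (k : scalar_kind) (E : normedModType (scalars R k)).
Implicit Types S T : clinear E E.

Lemma approx_number_comp n (A B S : clinear E E) :
  approx_number n.+1 (clinear_comp A (clinear_comp S B))
    <= op_norm A * op_norm B * approx_number n.+1 S.
Proof.
apply: approx_number_scale; first by rewrite mulr_ge0 ?op_norm_ge0.
move=> D Dn; exists (clinear_comp A (clinear_comp D B)).
  exact: rank_lt_comp.
rewrite (_ : _ - _ = clinear_comp A (clinear_comp (S - D) B)); last first.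
  by apply/clinearP => x /=; rewrite [RHS](linearB A).
apply: (le_trans (op_norm_comp _ _)); rewrite -mulrA.
rewrite ler_wpM2l ?op_norm_ge0// [leRHS]mulrC; exact: op_norm_comp.
Qed.

Local Open Scope ereal_scope.

(* The sequence of approximation numbers is indexed from 1. *)
Definition schatten_norm (p : R) (S : clinear E E) : \bar R :=
  Lnorm counting p%:E (fun n => (approx_number n.+1 S)%:E).

Context (p : R) (p0 : (0 < p)%R).

Let pow S : \bar R := \sum_(n <oo) (approx_number n.+1 S `^ p)%:E.

Let pow_ge0 S : 0 <= pow S.
Proof. by apply: nneseries_ge0 => n _ _; rewrite lee_fin powR_ge0. Qed.

Let schatten_normE S : schatten_norm p S = pow S `^ p^-1.
Proof.
rewrite /schatten_norm Lnorm_counting//; congr (_ `^ _).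
apply: eq_eseriesr => n _; rewrite abse_EFin ger0_norm ?approx_number_ge0//.
Qed.

Let pow_scale S S' M : (0 <= M)%R ->
  (forall n, approx_number n.+1 S' <= M * approx_number n.+1 S)%R ->
  pow S' <= (M `^ p)%:E * pow S.
Proof.
move=> M0 h; rewrite /pow -nneseriesZl//; last first.
  by move=> n _; rewrite lee_fin powR_ge0.
apply: lee_nneseries => n _; first by rewrite lee_fin powR_ge0.
rewrite -EFinM lee_fin -powRM ?approx_number_ge0//.
apply: ge0_ler_powR; last exact: h.
- exact: ltW.
- by rewrite nnegrE approx_number_ge0.
- by rewrite nnegrE mulr_ge0// approx_number_ge0.
Qed.

Let powD S T : pow (S + T)%R <= (2 * 2 `^ p)%:E * (pow S + pow T).
Proof.
pose g n := (approx_number n.+1 S `^ p + approx_number n.+1 T `^ p)%R.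
have g0 n : 0 <= (g n)%:E by rewrite lee_fin addr_ge0 ?powR_ge0.
have -> : pow S + pow T = \sum_(n <oo) (g n)%:E.
  by rewrite /pow -nneseriesD// => n _ _; rewrite lee_fin powR_ge0.
pose f n := (approx_number n.+1 (S + T) `^ p)%R.
have fg n m : (n.*2 <= m)%N -> (f m <= 2 `^ p * g n)%R.
  move=> nm; apply: le_trans (powRD_le _ _ _) => //;
    [|exact: approx_number_ge0|exact: approx_number_ge0].
  apply: ge0_ler_powR; first exact: ltW.
  - by rewrite nnegrE approx_number_ge0.
  - by rewrite nnegrE addr_ge0// approx_number_ge0.
  apply: le_trans (approx_number_mono (S + T)%R nm) _.
  by rewrite -addnn; exact: approx_numberD.
have sumfg N : (\sum_(0 <= i < N.*2) f i <= 2 * 2 `^ p * \sum_(0 <= i < N) g i)%R.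
  elim: N => [|N IH]; first by rewrite !big_nil mulr0.
  rewrite doubleS !big_nat_recr//= -addrA mulrDr lerD//.
  by rewrite -mulrA mulr2n mulrDl mul1r lerD// fg.
apply: lime_le; first by apply: is_cvg_nneseries => n _ _; rewrite lee_fin powR_ge0.
apply: nearW => N.
apply: (@le_trans _ _ (\sum_(0 <= i < N.*2) (f i)%:E)).
  rewrite [leRHS](big_cat_nat _ (n := N))//= ?leeDl//.
    by apply: sume_ge0 => i _; rewrite lee_fin powR_ge0.
  by rewrite -addnn leq_addr.
rewrite sumEFin; apply: le_trans (_ : (2 * 2 `^ p * \sum_(0 <= i < N) g i)%:E <= _).
  by rewrite lee_fin.
rewrite EFinM lee_wpmul2l ?lee_fin ?mulr_ge0 ?powR_ge0// -sumEFin.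
exact: (@nneseries_lim_ge _ _ xpredT).
Qed.

Let schatten_norm_ltE S e : (0 < e)%R ->
  (schatten_norm p S < e%:E) = (pow S < (e `^ p)%:E).
Proof.
move=> e0; rewrite schatten_normE.
have eE : e = ((e `^ p) `^ p^-1)%R.
  by rewrite -powRrM mulfV ?gt_eqF// powRr1// ltW.
have := pow_ge0 S; case: (pow S) => [r| |//]; last first.
  by rewrite poweRyr ?invr_eq0 ?gt_eqF// !ltNge !leey.
rewrite lee_fin poweR_EFin !lte_fin => r0; rewrite [in LHS]eE.
apply/idP/idP => [|h].
  apply: contraTT; rewrite -!leNgt => h.
  by apply: ge0_ler_powR => //; rewrite ?invr_ge0 ?nnegrE ?powR_ge0// ltW.
by apply: gt0_ltr_powR; rewrite ?invr_gt0 ?nnegrE ?powR_ge0.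
Qed.

Lemma schatten_norm_lty S : (schatten_norm p S < +oo) = (pow S < +oo).
Proof.
rewrite schatten_normE; apply/idP/idP; last exact: poweR_lty.
by apply: lty_poweRy; rewrite invr_eq0 gt_eqF.
Qed.

Lemma schatten_norm_ge0 S : 0 <= schatten_norm p S.
Proof. exact: Lnorm_ge0. Qed.

Lemma schatten_norm_scale S S' M : (0 <= M)%R ->
  (forall n, approx_number n.+1 S' <= M * approx_number n.+1 S)%R ->
  schatten_norm p S' <= M%:E * schatten_norm p S.
Proof.
move=> M0 h; rewrite !schatten_normE.
have -> : M%:E = (M `^ p)%:E `^ p^-1.
  by rewrite poweR_EFin -powRrM mulfV ?gt_eqF// powRr1.
rewrite -poweRM ?lee_fin ?powR_ge0//.
apply: gt0_ler_poweR; last exact: pow_scale.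
- by rewrite invr_ge0 ltW.
- by rewrite in_itv/= leey pow_ge0.
- by rewrite in_itv/= leey andbT mule_ge0// lee_fin powR_ge0.
Qed.

Lemma schatten_normZ a S :
  schatten_norm p (a *: S)%R <= (rnorm (a : scalars R k))%:E * schatten_norm p S.
Proof.
by apply: schatten_norm_scale => [|n]; [exact: rnorm_ge0|exact: approx_numberZ].
Qed.

Lemma schatten_normN S : schatten_norm p (- S)%R = schatten_norm p S.
Proof.
have h T : schatten_norm p (- T)%R <= schatten_norm p T.
  rewrite -scaleN1r -[leRHS]mul1e; apply: le_trans (schatten_normZ _ _) _.
  suff -> : rnorm (-1 : scalars R k) = 1%R by [].
  rewrite rnormN -[X in _ = X]normr1 -(rnorm_scalar_of k).
  by rewrite /scalar_of /scalars; case: (k).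
have := h (- S)%R; rewrite opprK => hN.
by apply/le_anti/andP; split; [exact: h|exact: hN].
Qed.

Lemma schatten_norm0 : schatten_norm p 0%R = 0.
Proof.
apply/le_anti/andP; split; last exact: schatten_norm_ge0.
have := schatten_normZ 0%R (0%R : clinear E E).
by rewrite scale0r rnorm0 mul0e.
Qed.

Lemma schatten_norm_comp A B S :
  schatten_norm p (clinear_comp A (clinear_comp S B))
    <= (op_norm A * op_norm B)%:E * schatten_norm p S.
Proof.
apply: schatten_norm_scale => [|n]; first by rewrite mulr_ge0 ?op_norm_ge0.
exact: approx_number_comp.
Qed.

Let lty_pow S : schatten_norm p S < +oo -> pow S < +oo.
Proof. by rewrite schatten_norm_lty. Qed.

Let lt_pow S e : (0 < e)%R -> schatten_norm p S < e%:E -> pow S < (e `^ p)%:E.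
Proof. by move=> e0; rewrite schatten_norm_ltE. Qed.

Lemma schatten_normD_lty S T : schatten_norm p S < +oo ->
  schatten_norm p T < +oo -> schatten_norm p (S + T)%R < +oo.
Proof.
move=> /lty_pow Soo /lty_pow Too; rewrite schatten_norm_lty.
apply: le_lt_trans (powD S T) _; apply: lte_mul_pinfty => //.
exact: (lte_add_pinfty Soo Too).
Qed.

Lemma schatten_normD_near0 (e : R) : (0 < e)%R -> exists2 d : R, (0 < d)%R &
  forall S T, schatten_norm p S < d%:E -> schatten_norm p T < d%:E ->
    schatten_norm p (S + T)%R < e%:E.
Proof.
move=> e0; pose b : R := (2 * 2 `^ p)%R.
have b0 : (0 < b)%R by rewrite mulr_gt0// powR_gt0.
pose c := (e `^ p / b / 2)%R.
have c0 : (0 < c)%R by rewrite !divr_gt0// powR_gt0.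
pose d := (c `^ p^-1)%R; have d0 : (0 < d)%R by rewrite powR_gt0.
have dE : (d `^ p = c)%R by rewrite -powRrM mulVf ?gt_eqF// powRr1// ltW.
exists d => // S T /(lt_pow d0) + /(lt_pow d0); rewrite dE => Sd Td.
rewrite schatten_norm_ltE//; apply: le_lt_trans (powD S T) _.
have -> : (e `^ p)%:E = b%:E * (c + c)%:E.
  by rewrite -EFinM -splitr mulrC divfK// gt_eqF.
rewrite lte_pmul2l //.
by rewrite EFinD; exact: (lteD Sd Td).
Qed.

End SchattenNorm.

Section Schatten.
Context (R : realType) (k : scalar_kind) (H : hilbertType R k).
Context (p : R) (p1 : 1 <= p).

Let p0 : 0 < p. Proof. exact: lt_le_trans ltr01 p1. Qed.

(* The hypothesis on p, used for closure under addition, is an argument of the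
   type so that the module and topological structures can be inferred. *)
Definition schatten_pred of 1 <= p : {pred (clinear H H)} :=
  mem [set S : clinear H H | (schatten_norm p S < +oo)%E].

Record schatten := Schatten {
  schatten_op :> clinear H H ;
  _ : schatten_op \in schatten_pred p1 }.

HB.instance Definition _ := [isSub for schatten_op].
HB.instance Definition _ := [Choice of schatten by <:].

Fact schatten_submod_closed : submod_closed (schatten_pred p1).
Proof.
split=> [|a S T]; rewrite !inE /=; first by rewrite schatten_norm0// ltry.
move=> Soo Too; apply: schatten_normD_lty => //.
apply: le_lt_trans (schatten_normZ p0 a S) _; apply: lte_mul_pinfty => //.
exact: rnorm_ge0.
Qed.

HB.instance Definition _ := GRing.isSubmodClosed.Build (scalars R k)
  (clinear H H) (schatten_pred p1) schatten_submod_closed.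
HB.instance Definition _ := [SubChoice_isSubLmodule of schatten by <:].

Lemma schatten_lty (S : schatten) : (schatten_norm p S < +oo)%E.
Proof. by case: S => S /=; rewrite inE. Qed.

(* the topology generated by the balls of the Schatten norm *)
Definition schatten_nbhs (S : schatten) (A : set schatten) :=
  exists2 e : R, 0 < e &
    [set T : schatten | (schatten_norm p (T - S)%R < e%:E)%E] `<=` A.

HB.instance Definition _ := hasNbhs.Build schatten schatten_nbhs.

Lemma schatten_nbhsP (S : schatten) (A : set schatten) :
  nbhs S A <-> exists2 e : R, 0 < e &
    forall T : schatten, (schatten_norm p (T - S)%R < e%:E)%E -> A T.
Proof. by []. Qed.

Lemma schatten_ball_center (S : schatten) (e : R) : 0 < e ->
  (schatten_norm p (S - S)%R < e%:E)%E.
Proof. by move=> e0; rewrite subrr schatten_norm0. Qed.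

Fact schatten_nbhs_filter (S : schatten) : ProperFilter (nbhs S).
Proof.
apply: Build_ProperFilter_ex.
  by move=> A [e e0 SA]; exists S; apply: SA; exact: schatten_ball_center.
split; first by exists 1.
  move=> A B [e e0 SA] [f f0 SB]; exists (Num.min e f).
    by rewrite lt_min e0.
  move=> T /= ST; split; [apply: SA|apply: SB]; apply: (lt_le_trans ST).
    by rewrite lee_fin ge_min lexx.
  by rewrite lee_fin ge_min lexx orbT.
by move=> A B AB [e e0 SA]; exists e => //; exact: subset_trans AB.
Qed.

Fact schatten_nbhs_singleton (S : schatten) A : nbhs S A -> A S.
Proof. by move=> [e e0]; apply; exact: schatten_ball_center. Qed.

Fact schatten_nbhs_nbhs (S : schatten) A : nbhs S A -> nbhs S (nbhs^~ A).
Proof.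
move=> [e e0 SA]; have [d d0 dP] := schatten_normD_near0 H p0 e0.
exists d => // T /= TS; exists d => // U /= UT; apply: SA => /=.
have -> : val U - val S = (val U - val T) + (val T - val S) by rewrite addrA subrK.
exact: dP.
Qed.

HB.instance Definition _ := Nbhs_isNbhsTopological.Build schatten
  schatten_nbhs_filter schatten_nbhs_singleton schatten_nbhs_nbhs.

Fact schatten_add_continuous : continuous (fun x : schatten * schatten => x.1 + x.2).
Proof.
move=> [S T] A [e e0 STA] /=; have [d d0 dP] := schatten_normD_near0 H p0 e0.
exists ([set S' : schatten | (schatten_norm p (S' - S)%R < d%:E)%E],
        [set T' : schatten | (schatten_norm p (T' - T)%R < d%:E)%E]).
  by split; exists d.
move=> [S' T'] [/= SS' TT']; apply: STA => /=.
have -> : val (S' + T') - val (S + T) = (val S' - val S) + (val T' - val T).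
  by rewrite -[val (S' + T')]/(val S' + val T') -[val (S + T)]/(val S + val T) opprD addrACA.
exact: dP.
Qed.

HB.instance Definition _ :=
  PreTopologicalNmodule_isTopologicalNmodule.Build schatten schatten_add_continuous.

Fact schatten_scale_continuous :
  continuous (fun z : (scalars R k)^o * schatten => z.1 *: z.2).
Proof.
move=> [a S] A [e e0 aSA] /=; have [d d0 dP] := schatten_normD_near0 H p0 e0.
pose s := fine (schatten_norm p S).
have sE : schatten_norm p S = s%:E.
  by rewrite fineK// ge0_fin_numE ?schatten_lty// schatten_norm_ge0.
have s0 : 0 <= s by rewrite -lee_fin -sE schatten_norm_ge0.
pose b := rnorm a + 1; have b0 : 0 < b by rewrite ltr_wpDl ?rnorm_ge0.
pose c := Num.min 1 (d / (s + 1)).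
have c0 : 0 < c by rewrite lt_min ltr01 divr_gt0// ltr_wpDl.
exists ([set a' : scalars R k | `|a - a'| < scalar_of k c],
        [set T : schatten | (schatten_norm p (T - S)%R < (d / b)%:E)%E]) => /=.
  split; last by exists (d / b) => //; rewrite divr_gt0.
  by exists (scalar_of k c) => //=; rewrite -(scalar_of0 R k) scalar_of_lt.
move=> [a' T] [/= aa' TS]; apply: aSA => /=.
move: aa'; rewrite lt_rnorm -rnormN opprB => aa'.
have -> : val (a' *: T) - val (a *: S) = a' *: (val T - val S) + (a' - a) *: val S.
  by rewrite scalerBr scalerBl addrA subrK.
apply: dP.
  apply: le_lt_trans (schatten_normZ p0 a' (val T - val S)) _.
  have a'b : rnorm a' < b.
    rewrite -[a'](subrK a) addrC; apply: le_lt_trans (rnormD _ _) _.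
    by rewrite ltrD2l; apply: lt_le_trans aa' _; rewrite ge_min lexx.
  apply: (@le_lt_trans _ _ (b%:E * schatten_norm p (T - S)%R)%E).
    by apply: lee_wpmul2r; [exact: schatten_norm_ge0|rewrite lee_fin ltW].
  by rewrite -lte_pdivlMl// muleC -EFinM.
apply: le_lt_trans (schatten_normZ p0 (a' - a) (val S)) _.
rewrite sE -EFinM lte_fin; apply: (@le_lt_trans _ _ (rnorm (a' - a) * (s + 1))).
  by rewrite ler_wpM2l ?rnorm_ge0// lerDl.
rewrite -ltr_pdivlMr ?ltr_wpDl//; apply: lt_le_trans aa' _.
by rewrite ge_min lexx orbT.
Qed.

HB.instance Definition _ := TopologicalNmodule_isTopologicalLmodule.Build
  (scalars R k) schatten schatten_scale_continuous.

Section TwoSidedMultiplication.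
Variables A B : clinear H H.

Fact schatten_comp_subproof (S : schatten) :
  clinear_comp A (clinear_comp S B) \in schatten_pred p1.
Proof.
rewrite inE /=; apply: le_lt_trans (schatten_norm_comp p0 A B S) _.
apply: lte_mul_pinfty => //; last exact: schatten_lty.
by rewrite lee_fin mulr_ge0// op_norm_ge0.
Qed.

Definition two_sided_mul_fun (S : schatten) : schatten :=
  Schatten (schatten_comp_subproof S).

Fact two_sided_mul_linear : linear two_sided_mul_fun.
Proof.
move=> a S T; apply/val_inj/clinearP => x /=.
by rewrite [LHS](linearP A).
Qed.

Fact two_sided_mul_continuous : continuous two_sided_mul_fun.
Proof.
move=> S V [e e0 SV]; pose c := op_norm A * op_norm B + 1.
have c0 : 0 < c by rewrite ltr_wpDl// mulr_ge0// op_norm_ge0.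
exists (e / c); first by rewrite divr_gt0.
move=> T /= TS; apply: SV => /=.
rewrite [X in schatten_norm p X](_ : _ =
    clinear_comp A (clinear_comp (val T - val S) B)); last first.
  by apply/clinearP => x; rewrite /= [RHS](linearB A).
apply: le_lt_trans (schatten_norm_comp p0 A B (val T - val S)) _.
apply: (@le_lt_trans _ _ (c%:E * schatten_norm p (T - S)%R)%E).
  by apply: lee_wpmul2r; [exact: schatten_norm_ge0|rewrite lee_fin lerDl].
by rewrite -lte_pdivlMl// muleC -EFinM.
Qed.

(* S |-> A S B on the Schatten class *)
Definition two_sided_mul : clinear schatten schatten :=
  mk_clinear two_sided_mul_linear two_sided_mul_continuous.

End TwoSidedMultiplication.

End Schatten.

Definition separable (X : topologicalType) : Prop :=
  exists2 D : set X, countable D & dense D.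

(* The choice is determined, as at most one operator has this property; such
   an operator exists by the Riesz representation theorem. *)
Definition adjoint (R : realType) (k : scalar_kind) (H : hilbertType R k)
    (T : clinear H H) : clinear H H :=
  xget 0 [set S : clinear H H | forall x y, inner (T x) y = inner x (S y)].

(* Meant for families of non-negative terms: f r is summed over the indices
   satisfying P r, and the tails are small uniformly in r. *)
Definition uniformly_summable (R : realType)
    (P : nat -> pred nat) (f : nat -> nat -> R) : Prop :=
  forall e : R, 0 < e -> exists N : nat, forall r : nat,
    (\sum_(N <= n <oo | P r n) (f r n)%:E < e%:E)%E.

(* Times n range over the positive integers; the term of index N = 0 is
   irrelevant to the lower limit. *)
Definition q_frequently_hypercyclic (R : realType) (k : scalar_kind)
    (q : nat) (E : topologicalLmodType (scalars R k)) (A : clinear E E) : Prop :=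
  exists x : E, forall V : set E, open V -> V !=set0 ->
    (0 < limn_einf (fun N : nat =>
       ((#|[pred n : 'I_(N ^ q).+1 | (0 < n)%N && `[< V (iter n A x) >]]|%:R
          / N%:R : R)%:E)))%E.

(* Main.v *)
Require Import Defs.
From mathcomp Require Import all_boot all_order all_algebra.
From mathcomp Require Import all_classical all_reals all_analysis.
From mathcomp Require Import complex zify ring lra.
Import Order.TTheory GRing.Theory Num.Theory.
Import numFieldNormedType.Exports.
Local Open Scope classical_set_scope.
Local Open Scope ring_scope.

(** The map C : S |-> R S T sends the rank-one operator u ⊗ v = <., v> u to
    (R u) ⊗ (T* v), so its orbits on rank-one operators are explicit, and the
    orthogonality in (b) makes them summable: if the u_n are pairwise
    orthogonal and so are the v_n, then the approximation numbers of
    sum_n u_n ⊗ v_n are at most the numbers |u_n| |v_n| in decreasing order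
    ([schatten_norm_orthogonal_sum], from Pythagoras and Bessel). Thus (a)
    implies that, for x in D1 and y in D2, the series of the operators
    C^(r^q - (r-n)^q) (x ⊗ y) and of the operators
    x_((n+r)^q - r^q) ⊗ y_((n+r)^q - r^q) converge unconditionally in S_p,
    uniformly in r, and (c) says that the operators x_n ⊗ y_n are preimages of
    x ⊗ y along the iterates of C. Both properties pass to linear combinations
    ([summable_orbits]), and these combinations are dense in S_p
    ([sum_tensor_dense]): operators of finite rank are dense, and they are
    finite sums of rank-one operators by the Riesz representation theorem.

    It remains to apply a frequent hypercyclicity criterion along q-th powers
    ([q_frequent_hypercyclicity_criterion]). Let w_0, w_1, ... be dense with
    preimages b_l(n) of w_l, and let J_0, J_1, ... be disjoint sets of positive
    lower density such that a point of J_i and a point of J_l are always at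
    distance at least N_i + N_l, where the thresholds N_l grow as fast as the
    convergence of the series of w_0, ..., w_l requires ([spread_sets]). The
    vector x = sum_l sum_(m in J_l) b_l(m^q) then satisfies C^(n^q) x ~ w_l for n in
    J_l: the term m = n is w_l, the terms m < n are orbit points
    C^(n^q - m^q) w_i and the terms m > n are preimages b_i(m^q - n^q), whose
    sums are small by the gaps between n and the m.

    These sums are estimated along a sequence of neighbourhoods U_j of 0 with
    U_(j+1) + U_(j+1) contained in U_j, which the quasi-triangle inequality of
    the Schatten norm provides. *)

(** * Sparse sets of positive lower density *)

Section SpreadSets.
Local Open Scope nat_scope.

(** With v the 2-adic valuation, this is v n + 2 * (v 1 + ... + v n.-1). The
    points [ruler n] leave a gap of at least v m + v n between those of index m < n, while
    v has mean value at most 1, so that they still have positive density. *)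
Definition ruler (n : nat) : nat := logn 2 n`! + logn 2 n.-1`!.

Lemma logn_factS n : logn 2 n.+1`! = logn 2 n.+1 + logn 2 n`!.
Proof. by rewrite factS lognM ?fact_gt0. Qed.

Lemma ruler_gap m n : 0 < m -> m < n -> ruler m + logn 2 m + logn 2 n <= ruler n.
Proof.
case: m => // m _; case: n => // n mn; rewrite /ruler !logn_factS /=.
have : forall i, m.+1 <= i -> logn 2 m.+1 + logn 2 m`! <= logn 2 i`!.
  elim=> // i IH; rewrite leq_eqVlt => /predU1P[<-|/IH h]; rewrite logn_factS//.
  by apply: leq_trans h _; rewrite leq_addl.
by move=> /(_ _ mn); lia.
Qed.

(** One of two consecutive numbers is even, so consecutive gaps are positive. *)
Lemma ruler_mono m n : 0 < m -> m < n -> ruler m < ruler n.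
Proof.
move=> m0 mn.
have gapS i : 0 < i -> ruler i < ruler i.+1.
  move=> i0; apply: leq_trans (ruler_gap _ _ i0 (ltnSn i)).
  suff : 0 < logn 2 i + logn 2 i.+1 by lia.
  rewrite addn_gt0 !logn_gt0 !mem_primes /= i0 !dvdn2 /=.
  by case: (odd i).
have /(_ n mn) // : forall i, m < i -> ruler m < ruler i.
elim=> // i IH; rewrite ltnS leq_eqVlt => /predU1P[<-|mi]; first exact: gapS.
by apply: ltn_trans (IH mi) (gapS _ _); exact: leq_trans mi.
Qed.

Lemma logn2_fact_le n : logn 2 n`! <= n.
Proof.
elim/ltn_ind: n => n IH; case: (posnP n) => [->//|n0].
have half m : logn 2 m.*2`! = m + logn 2 m`!.
  elim: m => // m IHm; rewrite doubleS !logn_factS IHm.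
  have -> : logn 2 m.*2.+2 = (logn 2 m.+1).+1.
    by rewrite -doubleS -mul2n lognM// logn_prime.
  have -> : logn 2 m.*2.+1 = 0 by rewrite lognE /= dvdn2 /= odd_double.
  lia.
have [m [nE|nE]] : exists m, n = m.*2 \/ n = m.*2.+1.
  exists n./2; have := odd_double_half n.
  by case: (odd n) => /= nE; [right|left]; rewrite -[LHS]nE.
- by have := IH m; rewrite nE half; lia.
- have := IH m; rewrite nE logn_factS half.
  have -> : logn 2 m.*2.+1 = 0 by rewrite lognE /= dvdn2 /= odd_double.
  lia.
Qed.

Lemma ruler_le n : ruler n <= n.*2.
Proof.
by have := logn2_fact_le n; have := logn2_fact_le n.-1; rewrite /ruler; lia.
Qed.

Lemma logn2_odd a i : logn 2 (2 ^ a * i.*2.+1) = a.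
Proof.
by rewrite lognM ?expn_gt0// pfactorK// [X in _ + X]lognE /= dvdn2 /= odd_double addn0.
Qed.

(** J k consists of the points [ruler n] with n of 2-adic valuation (N k).+1.
    These n form an arithmetic progression and [ruler] grows linearly, so the
    density is positive however fast N grows. *)
Lemma spread_sets (N : nat -> nat) : {homo N : i j / i < j} ->
  exists J : nat -> pred nat,
  [/\ forall k m, J k m -> N k < m,
      forall k l m, J k m -> J l m -> k = l,
      forall k l m n, J k m -> J l n -> m < n -> N k + N l <= n - m
    & forall k, exists c, forall M,
        M %/ c.+1 <= #|[pred m : 'I_M.+1 | J k m]| ].
Proof.
move=> Nmono; pose P k m n := [&& 0 < n, ruler n == m & logn 2 n == (N k).+1].
pose J k : pred nat := fun m => `[< exists n, P k m n >].
exists J; split.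
- move=> k m /asboolP[n /and3P[n0 /eqP <- /eqP nk]].
  rewrite /ruler; case: n n0 nk => // n _ nk; rewrite logn_factS nk; lia.
- move=> k l m /asboolP[n /and3P[n0 /eqP nm /eqP nk]].
  move=> /asboolP[n' /and3P[n'0 /eqP n'm /eqP nl]].
  have nn' : n = n'.
    case: (ltngtP n n') => // /ruler_mono; rewrite nm n'm ltnn.
      by move=> /(_ n0).
    by move=> /(_ n'0).
  move: nk; rewrite nn' nl => -[]; case: (ltngtP k l) => // /Nmono; lia.
- move=> k l m n /asboolP[i /and3P[i0 /eqP <- /eqP ik]].
  move=> /asboolP[j /and3P[j0 /eqP <- /eqP jl]] ij.
  have lt_ij : i < j.
    rewrite ltnNge; apply/negP; rewrite leq_eqVlt => /predU1P[ji|ji].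
      by rewrite ji ltnn in ij.
    by have := ruler_mono _ _ j0 ji; lia.
  by have := ruler_gap _ _ i0 lt_ij; rewrite ik jl; lia.
- move=> k; set a := (N k).+1; exists (2 ^ a.+2).-1 => M.
  rewrite prednK ?expn_gt0//.
  (* The indices of valuation a are the numbers 2 ^ a * (2 * i + 1). *)
  pose g (i : nat) : nat := ruler (2 ^ a * i.*2.+1).
  have gM (i : nat) : i < M %/ 2 ^ a.+2 -> g i < M.+1.
    rewrite ltnS => iQ; apply: leq_trans (ruler_le _) _.
    have := leq_trunc_div M (2 ^ a.+2); rewrite !expnS in iQ *.
    by move: (M %/ _) iQ => Q; nia.
  pose h (i : 'I_(M %/ 2 ^ a.+2)) : 'I_M.+1 := Ordinal (gM i (ltn_ord i)).
  have h_inj : injective h; last first.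
    rewrite -[leqLHS]card_ord -(card_imset _ h_inj).
    apply: subset_leq_card; apply/fintype.subsetP => _ /imsetP[i _ ->].
    suff : exists n, P k (g i) n by move=> /asboolP.
    exists (2 ^ a * i.*2.+1).
    by rewrite /P muln_gt0 expn_gt0 /= eqxx /= logn2_odd.
  move=> i j /(congr1 val) /= gij; apply/val_inj => /=.
  have pos (i' : nat) : 0 < 2 ^ a * i'.*2.+1 by rewrite muln_gt0 expn_gt0.
  have : 2 ^ a * i.*2.+1 = 2 ^ a * j.*2.+1.
    case: (ltngtP (2 ^ a * i.*2.+1) (2 ^ a * j.*2.+1)) => // /ruler_mono;
    by rewrite -!/(g _) gij ltnn => /(_ (pos _)).
  by move/eqP; rewrite eqn_pmul2l ?expn_gt0// => /eqP; lia.
Qed.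

End SpreadSets.

(** * A criterion for frequent hypercyclicity along powers *)

Section Iterates.
Context {K : numFieldType} {E : topologicalLmodType K} (A : clinear E E).

Fact iter_clinear_linear n : linear (iter n A).
Proof. by elim: n => // n IH a x y; rewrite !iterS IH linearP. Qed.

Fact iter_clinear_continuous n : continuous (iter n A).
Proof.
elim: n => [|n IH] x; first exact: cvg_id.
exact: (@continuous_comp _ _ _ (iter n A) A x (IH x) (@clinear_continuous _ _ _ A _)).
Qed.

Definition clinear_iter n : clinear E E :=
  mk_clinear (@iter_clinear_linear n) (@iter_clinear_continuous n).

Lemma clinear_iterE n x : iter n A x = clinear_iter n x.
Proof. by []. Qed.

End Iterates.

Section Nbhs0.
Context {K : numFieldType} {E : topologicalLmodType K}.
Implicit Types (V W : set E).

Lemma nbhs0_add V : nbhs 0 V ->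
  exists2 W, nbhs 0 W & forall x y, W x -> W y -> V (x + y).
Proof.
move=> V0; have /= := @add_continuous E (0, 0) V; rewrite addr0.
move=> /(_ V0) [[W1 W2] [/= n1 n2] W12]; exists (W1 `&` W2); first exact: filterI.
by move=> x y [x1 _] [_ y2]; apply: (W12 (x, y)).
Qed.

Lemma nbhs0_scale V (a : K) : nbhs 0 V ->
  exists2 W, nbhs 0 W & forall x, W x -> V (a *: x).
Proof.
move=> V0; have /= := @scale_continuous K E (a, 0) V; rewrite scaler0.
move=> /(_ V0) [[W1 W2] [/= n1 n2] W12]; exists W2 => // x x2.
by apply: (W12 (a, x)); split => //=; exact: nbhs_singleton n1.
Qed.

(** Sequential completeness, phrased with neighbourhoods of 0 so that it makes
    sense on a topological vector space that carries no uniform structure. *)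
Definition seq_complete := forall u : nat -> E,
  (forall V, nbhs 0 V ->
     exists N, forall m n, (N <= m)%N -> (m <= n)%N -> V (u n - u m)) ->
  exists x : E, u @ \oo --> x.

(** A substitute for a metric: sums are estimated by spending U_(j+1),
    U_(j+2), ... on their successive terms. *)
Definition halving_base (U : nat -> set E) :=
  [/\ forall j, nbhs 0 (U j),
      forall V, nbhs 0 V -> exists j, U j `<=` V
    & forall j x y, U j.+1 x -> U j.+1 y -> U j (x + y)].

Lemma halving_base0 U j : halving_base U -> U j 0.
Proof. by move=> [U0 _ _]; exact: nbhs_singleton. Qed.

Lemma halving_base_sub U i j : halving_base U -> (i <= j)%N -> U j `<=` U i.
Proof.
move=> hU; elim: j => [|j IH]; first by rewrite leqn0 => /eqP ->.
rewrite leq_eqVlt => /predU1P[->//|/IH] ij; apply: subset_trans ij.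
have [_ _ UD] := hU => x x1; rewrite -[x]addr0; apply: UD => //.
exact: halving_base0.
Qed.

Lemma halving_base_sum U (s : nat -> E) j n : halving_base U ->
  (forall k, (k < n)%N -> U (j + k).+1 (s k)) -> U j (\sum_(0 <= k < n) s k).
Proof.
move=> hU; elim: n j s => [|n IH] j s sU.
  by rewrite big_nil; exact: halving_base0.
rewrite big_nat_recl//; have [_ _ UD] := hU; apply: UD.
  by have := sU 0%N erefl; rewrite addn0.
by apply: IH => k kn; have := sU k.+1; rewrite addnS addSn; exact.
Qed.

End Nbhs0.

Section SummableOrbits.
Context {K : numFieldType} {E : topologicalLmodType K} (A : clinear E E) (q : nat).

(** Unconditional Cauchy condition, uniform in the parameter r: the sum over
    any finite set of indices beyond N is small. *)
Definition small_tails (P : nat -> pred nat) (g : nat -> nat -> E) :=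
  forall V, nbhs 0 V -> exists N, forall r s, uniq s ->
    all (fun n => (N <= n)%N && P r n) s -> V (\sum_(n <- s) g r n).

Definition forward_orbit (w : E) (r n : nat) : E := iter (r ^ q - (r - n) ^ q) A w.
Definition backward_orbit (b : nat -> E) (r n : nat) : E := b ((n + r) ^ q - r ^ q)%N.

(** The points b n behave like preimages of w under the n-th iterates, as far
    as exponents that are q-th powers are concerned. *)
Definition preorbit (b : nat -> E) (w : E) :=
  (forall n, iter (n ^ q) A (b (n ^ q)%N) = w) /\
  (forall m n, (n < m)%N -> iter (n ^ q) A (b (m ^ q)%N) = b (m ^ q - n ^ q)%N).

(** The vectors to which the hypercyclicity criterion applies; unlike the
    hypotheses on rank-one operators, this is stable under linear
    combinations. *)
Definition summable_orbits (w : E) := exists b : nat -> E,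
  [/\ preorbit b w,
      small_tails (fun r n => (n <= r)%N) (forward_orbit w)
    & small_tails (fun _ => xpredT) (backward_orbit b)].

Lemma small_tailsD P f g : small_tails P f -> small_tails P g ->
  small_tails P (fun r n => f r n + g r n).
Proof.
move=> fP gP V /nbhs0_add[W W0 WV].
have [N1 h1] := fP W W0; have [N2 h2] := gP W W0.
exists (maxn N1 N2) => r s us /allP hs; rewrite big_split; apply: WV.
- by apply: h1 => //; apply/allP => n /hs; rewrite geq_max -andbA => /and3P[-> _ ->].
- by apply: h2 => //; apply/allP => n /hs; rewrite geq_max -andbA => /and3P[_ -> ->].
Qed.

Lemma small_tailsZ P a f : small_tails P f -> small_tails P (fun r n => a *: f r n).
Proof.
move=> fP V /(nbhs0_scale _ a)[W W0 WV]; have [N h] := fP W W0.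
by exists N => r s us hs; rewrite -scaler_sumr; exact/WV/h.
Qed.

Lemma summable_orbits0 : summable_orbits 0.
Proof.
exists (fun=> 0); split; last first.
- by move=> V V0; exists 0%N => r s _ _; rewrite big1//; exact: nbhs_singleton.
- move=> V V0; exists 0%N => r s _ _.
  rewrite big1 => [|i _]; first exact: nbhs_singleton.
  by rewrite /forward_orbit clinear_iterE linear0.
by split => *; rewrite clinear_iterE linear0.
Qed.

Lemma summable_orbitsD w1 w2 :
  summable_orbits w1 -> summable_orbits w2 -> summable_orbits (w1 + w2).
Proof.
move=> [b1 [[i1 l1] f1 g1]] [b2 [[i2 l2] f2 g2]]; exists (fun n => b1 n + b2 n); split.
- split => [n|m n mn]; first by rewrite -(i1 n) -[in RHS](i2 n) !clinear_iterE linearD.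
  by rewrite -l1// -l2// !clinear_iterE linearD.
- rewrite (_ : forward_orbit _ = fun r n => forward_orbit w1 r n + forward_orbit w2 r n).
    exact: small_tailsD.
  by apply/funext => r; apply/funext => n; rewrite /forward_orbit !clinear_iterE linearD.
- exact: small_tailsD g1 g2.
Qed.

Lemma summable_orbitsZ a w : summable_orbits w -> summable_orbits (a *: w).
Proof.
move=> [b [[i l] f g]]; exists (fun n => a *: b n); split.
- split => [n|m n mn]; first by rewrite -(i n) !clinear_iterE linearZ.
  by rewrite -l// !clinear_iterE linearZ.
- rewrite (_ : forward_orbit _ = fun r n => a *: forward_orbit w r n).
    exact: small_tailsZ.
  by apply/funext => r; apply/funext => n; rewrite /forward_orbit !clinear_iterE linearZ.
- exact: small_tailsZ g.
Qed.

End SummableOrbits.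

Lemma limn_einf_ge {R : realType} (u : nat -> \bar R) (c : \bar R) N :
  (forall n, (N <= n)%N -> (c <= u n)%E) -> (c <= limn_einf u)%E.
Proof.
move=> cu; rewrite limn_einf_lim; apply: lime_ge; first exact: is_cvg_einfs.
exists N => // n /= Nn; apply: le_ereal_inf_tmp => _ [m /= nm <-].
by apply: cu; exact: leq_trans nm.
Qed.

(** Sorts the terms of a double sum by their colour k instead of their position
    i. The bound k < i turns the range of the colours into a fixed one. *)
Lemma exchange_sum_below (V : nmodType) (J : nat -> pred nat)
    (F : nat -> nat -> V) m n K :
  (forall k i, J k i -> (k < i)%N) -> (n <= K)%N ->
  \sum_(m <= i < n) \sum_(0 <= k < i | J k i) F k i =
  \sum_(0 <= k < K) \sum_(i <- [seq i <- index_iota m n | J k i]) F k i.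
Proof.
move=> Jlt nK.
under [RHS]eq_bigr do rewrite big_filter big_mkcond /=.
rewrite exchange_big /=; apply: eq_big_nat => i /andP[_ ilt].
rewrite -big_mkcond /= [RHS](big_cat_nat _ (n := i))//=; last first.
  by apply: leq_trans nK; exact: ltnW.
rewrite [X in _ + X]big_nat_cond [X in _ + X]big1 ?addr0// => k.
by move=> /andP[/andP[ik _] /Jlt]; rewrite ltnNge ik.
Qed.

Section Criterion.
Context {R : realType} {k : scalar_kind} {E : topologicalLmodType (scalars R k)}.
Context (A : clinear E E) (q : nat) (q_gt0 : (0 < q)%N) (U : nat -> set E).
Context (hU : halving_base U) (E_complete : @seq_complete _ E).
Context (w : nat -> E) (w_good : forall l, summable_orbits A q (w l)).

Let tails_beyond (b : nat -> E) (v : E) j N :=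
  (forall r s, uniq s -> all (fun n => (N <= n)%N && (n <= r)%N) s ->
     U j (\sum_(n <- s) forward_orbit A q v r n)) /\
  (forall r s, uniq s -> all (fun n => N <= n)%N s ->
     U j (\sum_(n <- s) backward_orbit q b r n)).

(** The index 2 * max(i, l) + 3 leaves, for each l, room for summing over all
    i: the i-th term of the error around a point of the l-th class has to lie in
    U_(l+i+2). *)
Let tail_thresholds : exists (b : nat -> nat -> E) (N : nat -> nat),
  [/\ forall l, preorbit A q (b l) (w l), {homo N : i j / (i < j)%N}
    & forall i l, tails_beyond (b i) (w i) (2 * maxn i l + 3) (N (maxn i l))].
Proof.
have /choice[b bP] := w_good.
have [U0 _ _] := hU.
have : forall ij : nat * nat, exists N, tails_beyond (b ij.1) (w ij.1) (2 * ij.2 + 3) N.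
  move=> [i j]; have [_ /(_ _ (U0 (2 * j + 3)%N))[N1 h1]] := bP i.
  move=> /(_ _ (U0 (2 * j + 3)%N))[N2 h2]; exists (maxn N1 N2).
  split=> r s us /allP hs.
    by apply: h1 => //; apply/allP => n /hs; rewrite geq_max -andbA => /and3P[-> _ ->].
  by apply: h2 => //; apply/allP => n /hs; rewrite geq_max => /andP[_ ->].
move=> /choice[n nP].
exists b, (fun l => \sum_(0 <= j < l.+1) (\sum_(0 <= i < j.+1) n (i, j)).+1)%N; split.
- by move=> l; have [] := bP l.
- apply: homo_ltn => [|i]; first exact: ltn_trans.
  by rewrite [ltnRHS]big_nat_recr//= addnS ltnS leq_addr.
move=> i l; set j := maxn i l; set M := (\sum_(0 <= _ < _.+1) _)%N.
have nM : (n (i, j) <= M)%N.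
  have ij : (i <= j)%N by exact: leq_maxl.
  rewrite /M big_nat_recr//=; apply: leq_trans (leq_addl _ _); apply: leqW.
  rewrite (bigD1_seq i) ?iota_uniq ?mem_index_iota//=; exact: leq_addr.
have [h1 h2] := nP (i, j); split=> r s us /allP hs.
  apply: h1 => //; apply/allP => m /hs /andP[Mm ->]; rewrite andbT.
  exact: leq_trans nM Mm.
apply: h2 => //; apply/allP => m /hs; exact: leq_trans nM.
Qed.

(** The error around a point of the l-th class: the i-th class contributes the
    orbit points of w_i indexed by s_i and the preimages indexed by t_i. *)
Let combined_tails b N l r K (s t : nat -> seq nat) :
  (forall i l, tails_beyond (b i) (w i) (2 * maxn i l + 3) (N (maxn i l))) ->
  (forall i, uniq (s i) /\ all (fun n => (N (maxn i l) <= n)%N && (n <= r)%N) (s i)) ->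
  (forall i, uniq (t i) /\ all (fun n => N (maxn i l) <= n)%N (t i)) ->
  U l.+1 (\sum_(0 <= i < K) (\sum_(n <- s i) forward_orbit A q (w i) r n +
                             \sum_(n <- t i) backward_orbit q (b i) r n)).
Proof.
move=> bN sP tP; apply: halving_base_sum => // i _.
apply: (@halving_base_sub _ _ _ _ (2 * maxn i l + 2)) => //; first by lia.
have [_ _ UD] := hU; have [h1 h2] := bN i l; rewrite addnS in h1 h2.
have [us As] := sP i; have [ut At] := tP i.
by apply: UD; [exact: h1|exact: h2].
Qed.

(** The vector is the sum of the b_i(m^q) over m in J_i and all i. The same
    estimate [combined_tails] gives its convergence (take r = 0, where only
    preimages occur) and its behaviour at the times n^q with n in J_l. *)
Lemma q_frequent_hypercyclicity_criterion :
  (forall V, open V -> V !=set0 -> forall L, exists2 l, (L <= l)%N & V (w l)) ->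
  q_frequently_hypercyclic q A.
Proof.
move=> w_dense; have [b [N [wb Nmono bN]]] := tail_thresholds.
have [U0 Ubase UD] := hU.
have [J [JN Jinj Jgap Jdens]] := spread_sets N Nmono.
have Nle i j : (i <= j)%N -> (N i <= N j)%N.
  by rewrite leq_eqVlt => /predU1P[->//|/Nmono/ltnW].
have Nid i : (i <= N i)%N by elim: i => // i IH; exact: leq_ltn_trans IH (Nmono _ _ _).
have Nmax i j : N (maxn i j) = maxn (N i) (N j).
  by case: (leqP i j) => [ij|/ltnW ij]; have := Nle _ _ ij; lia.
have Jlt i m : J i m -> (i < m)%N by move=> /JN; exact: leq_ltn_trans.
pose c m := \sum_(0 <= i < m | J i m) b i (m ^ q)%N.
pose u n := \sum_(0 <= m < n) c m.
have uB m n : (m <= n)%N -> u n - u m = \sum_(m <= i < n) c i.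
  by move=> mn; rewrite /u (big_cat_nat _ (n := m))//= [LHS]addrC addKr.
have [x ux] : exists x : E, u @ \oo --> x.
  apply: E_complete => V /Ubase[l UV]; exists (N l) => m n lm mn; apply: UV.
  apply: (@halving_base_sub _ _ _ l l.+1) => //.
  rewrite uB// (exchange_sum_below _ _ _ _ _ n)//.
  have := @combined_tails b N l 0%N n (fun=> [::])
    (fun i => [seq m0 <- index_iota m n | J i m0]) bN.
  under eq_bigr do rewrite big_nil add0r /backward_orbit.
  under eq_bigr => i _ do under eq_bigr => ? ? do rewrite addn0 exp0n// subn0.
  apply => i; split=> //; first by rewrite filter_uniq// iota_uniq.
  apply/allP => j; rewrite mem_filter mem_index_iota Nmax => /and3P[/JN ij mj _].
  by lia.
have approx l n : J l n -> U l (iter (n ^ q) A x - w l).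
  move=> Jln; rewrite clinear_iterE; set g := clinear_iter A (n ^ q).
  have [M nM gM] : exists2 M, (n < M)%N & U l.+1 (g x - g (u M)).
    have gu : (g \o u) @ \oo --> g x.
      by apply: continuous_cvg ux; exact: clinear_continuous.
    have := @sub_continuous E (g x, g x) (U l.+1); rewrite /= subrr => /(_ (U0 l.+1)).
    move=> [[W1 W2] /= [/nbhs_singleton n1 n2] W12].
    have [M _ hM] := gu _ n2; exists (maxn M n.+1); first exact: leq_maxr.
    by apply: (W12 (g x, _)); split=> //=; apply: hM; exact: leq_maxl.
  rewrite -[g x](subrK (g (u M))) -addrA; apply: UD => //.
  have gc m : g (c m) = \sum_(0 <= i < m | J i m) g (b i (m ^ q)%N).
    by rewrite linear_sum.
  have gcn : g (c n) = w l.
    rewrite gc -big_filter (_ : [seq i <- _ | _] = [:: l]) ?big_seq1.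
      by have [+ _] := wb l; move/(_ n).
    apply: perm_small_eq => //; apply: uniq_perm => //.
      by rewrite filter_uniq// iota_uniq.
    move=> i; rewrite mem_filter mem_index_iota inE.
    apply/idP/eqP => [/andP[Jin _]|->]; first exact: Jinj Jin Jln.
    by rewrite Jln (Jlt _ _ Jln).
  have -> : g (u M) - w l = \sum_(0 <= m < n) g (c m) + \sum_(n.+1 <= m < M) g (c m).
    rewrite /u linear_sum (big_cat_nat _ (n := n))//=; last exact: ltnW.
    rewrite [X in _ + X - _]big_ltn// [iter _ _ (c n)]gcn.
    by rewrite -addrA [w l + _]addrC addrK.
  under eq_bigr do rewrite gc; under [X in _ + X]eq_bigr do rewrite gc.
  rewrite !(exchange_sum_below _ _ _ _ _ M)//; last exact: ltnW.
  rewrite -big_split /=.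
  have sub_inj (s : seq nat) (h : nat -> nat) :
     uniq s -> {in s &, injective h} -> uniq (map h s) by move=> ? /map_inj_in_uniq ->.
  have := @combined_tails b N l n M
    (fun i => map (fun m => (n - m)%N) [seq m <- index_iota 0 n | J i m])
    (fun i => map (fun m => (m - n)%N) [seq m <- index_iota n.+1 M | J i m]) bN.
  rewrite (_ : \sum_(_ <= _ < _) _ = \sum_(0 <= i < M)
      (\sum_(i0 <- [seq i0 <- index_iota 0 n | J i i0]) g (b i (i0 ^ q)%N) +
     \sum_(i0 <- [seq i0 <- index_iota n.+1 M | J i i0]) g (b i (i0 ^ q)%N))).
    apply=> i; split.
    - apply: sub_inj; first by rewrite filter_uniq// iota_uniq.
      move=> m m'; rewrite !mem_filter !mem_index_iota; lia.
    - apply/allP => _ /mapP[m + ->].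
      rewrite mem_filter mem_index_iota => /and3P[Jim _ mn].
      by rewrite Nmax leq_subr andbT; have := Jgap _ _ _ _ Jim Jln mn; lia.
    - apply: sub_inj; first by rewrite filter_uniq// iota_uniq.
      move=> m m'; rewrite !mem_filter !mem_index_iota; lia.
    - apply/allP => _ /mapP[m + ->].
      rewrite mem_filter mem_index_iota => /and3P[Jim nm _].
      by rewrite Nmax; have := Jgap _ _ _ _ Jln Jim nm; lia.
  apply: eq_bigr => i _; have [wb1 wb2] := wb i; rewrite !big_map; congr (_ + _).
    rewrite big_seq [RHS]big_seq; apply: eq_bigr => m.
    rewrite mem_filter mem_index_iota => /and3P[_ _ mn].
    rewrite /forward_orbit subKn; last exact: ltnW.
    rewrite -(wb1 m) -iterD subnK//; by rewrite leq_exp2r// ltnW.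
  rewrite big_seq [RHS]big_seq; apply: eq_bigr => m.
  rewrite mem_filter mem_index_iota => /and3P[_ nm _].
  by rewrite /backward_orbit subnK ?(ltnW nm)// -(wb2 m n).
exists x => V openV [v Vv].
(* A target index l >= j, with w_l near v, reaches V within the error U_l. *)
have [W [W0 Wv [j Wj]]] : exists W,
    [/\ open W, W v & exists j, forall y z, W y -> U j z -> V (z + y)].
  have /= := @add_continuous E (0, v) V; rewrite add0r.
  move=> /(_ (open_nbhs_nbhs (conj openV Vv))).
  move=> [[W1 W2] /= [/Ubase[j jW1] n2] W12].
  exists W2^°; split; [exact: open_interior|exact: n2|].
  by exists j => y z /interior_subset Wy /jW1 zU; apply: (W12 (z, y)).
have [l jl Wl] := w_dense W W0 (ex_intro _ v Wv) j.
have JV m : J l m -> V (iter (m ^ q) A x).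
  move=> Jm; rewrite -[iter _ _ _](subrK (w l)); apply: Wj => //.
  by apply: (halving_base_sub _ _ _ hU jl); exact: approx.
have [d dP] := Jdens l.
apply: (@lt_le_trans _ _ (((2 * d.+1)%:R^-1 : R)%:E)).
  by rewrite lte_fin invr_gt0 ltr0n.
apply: (@limn_einf_ge _ _ _ d.+1) => n dn; rewrite lee_fin.
have n0 : (0 < n)%N by apply: leq_trans dn.
rewrite ler_pdivlMr ?ltr0n// mulrC ler_pdivrMr ?ltr0n// -natrM ler_nat.
set C := #|_|; have : (n %/ d.+1 <= C)%N; last first.
  have := ltn_ceil n (ltn0Sn d).
  have : (0 < n %/ d.+1)%N by rewrite divn_gt0.
  by move: (n %/ d.+1)%N C; nia.
apply: leq_trans (dP n) _.
have mq (m : 'I_n.+1) : (m ^ q < (n ^ q).+1)%N.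
  by rewrite ltnS leq_exp2r// -ltnS.
pose h (m : 'I_n.+1) : 'I_(n ^ q).+1 := Ordinal (mq m).
have h_inj : injective h.
  by move=> m m' /(congr1 val) /= /eqP; rewrite eqn_exp2r// => /eqP /val_inj.
rewrite -(card_imset _ h_inj); apply: subset_leq_card.
apply/fintype.subsetP => _ /imsetP[m Jm ->]; rewrite !inE /= in Jm *.
by rewrite expn_gt0 (leq_ltn_trans _ (JN _ _ Jm))//=; apply/asboolP/JV.
Qed.

End Criterion.

(** * Geometry of Hilbert spaces and the Riesz representation *)

Section ScalarFacts.
Context {R : realType} {k : scalar_kind}.
Implicit Types (a b : scalars R k) (r s : R).

Lemma scalar_ofD r s : scalar_of k (r + s) = scalar_of k r + scalar_of k s.
Proof. by rewrite /scalar_of; case: k => //=; rewrite rmorphD. Qed.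

Lemma scalar_ofM r s : scalar_of k (r * s) = scalar_of k r * scalar_of k s.
Proof. by rewrite /scalar_of; case: k => //=; rewrite rmorphM. Qed.

Lemma scalar_of1 : scalar_of k (1 : R) = 1.
Proof. by rewrite /scalar_of; case: k. Qed.

Lemma scalar_of_inj : injective (@scalar_of R k).
Proof. exact: can_inj (@scalar_ofK R k). Qed.

Lemma rnormM a b : rnorm (a * b) = rnorm a * rnorm b.
Proof. by rewrite {1}/rnorm normrM [X in X * _]rnormE scalar_reM. Qed.

Lemma rnorm1 : rnorm (1 : scalars R k) = 1.
Proof. by rewrite -scalar_of1 rnorm_scalar_of normr1. Qed.

Lemma rnormV a : rnorm a^-1 = (rnorm a)^-1.
Proof.
have [->|a0] := eqVneq a 0; first by rewrite invr0 rnorm0 invr0.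
have na0 : rnorm a != 0 by apply: contra_neq a0; exact: rnorm_eq0.
by apply: (mulfI na0); rewrite -rnormM !mulfV// rnorm1.
Qed.

Lemma scalar_conj0 : scalar_conj (0 : scalars R k) = 0.
Proof. by rewrite /scalar_conj /scalars; case: k => //=; exact: conjc0. Qed.

Lemma scalar_conjK : involutive (@scalar_conj R k).
Proof. by rewrite /scalar_conj /scalars; case: k => //=; exact: conjcK. Qed.

End ScalarFacts.

Section InnerProduct.
Context {R : realType} {k : scalar_kind} {H : hilbertType R k}.
Implicit Types (x y z h u v : H) (a : scalars R k).

Lemma innerDl x y z : inner (x + y) z = inner x z + inner y z.
Proof. exact: linearDl. Qed.

Lemma innerDr z x y : inner z (x + y) = inner z x + inner z y.
Proof. exact: linearDr. Qed.

Lemma innerNl x y : inner (- x) y = - inner x y.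
Proof. exact: linearNl. Qed.

Lemma innerBl x y z : inner (x - y) z = inner x z - inner y z.
Proof. by rewrite innerDl innerNl. Qed.

Lemma innerBr z x y : inner z (x - y) = inner z x - inner z y.
Proof. exact: linearBr. Qed.

Lemma innerZl a x y : inner (a *: x) y = a * inner x y.
Proof. exact: linearZl_LR. Qed.

Lemma innerZr a x y : inner x (a *: y) = scalar_conj a * inner x y.
Proof. exact: linearZr_LR. Qed.

Lemma innerC x y : inner x y = scalar_conj (inner y x).
Proof. by rewrite (@hermitian_subproof _ _ _ _ inner) expr0 mul1r. Qed.

Lemma inner0l x : inner 0 x = 0. Proof. exact: linear0l. Qed.
Lemma inner0r x : inner x 0 = 0. Proof. exact: linear0r. Qed.

Lemma inner_suml (I : Type) (r : seq I) (P : pred I) (F : I -> H) x :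
  inner (\sum_(i <- r | P i) F i) x = \sum_(i <- r | P i) inner (F i) x.
Proof.
by elim/big_rec2: _ => [|i y1 y2 _ <-]; [rewrite inner0l|rewrite innerDl].
Qed.

Lemma inner_sumr (I : Type) (r : seq I) (P : pred I) (F : I -> H) x :
  inner x (\sum_(i <- r | P i) F i) = \sum_(i <- r | P i) inner x (F i).
Proof. exact: linear_sumr. Qed.

Lemma inner_orthC x y : inner x y = 0 -> inner y x = 0.
Proof. by move=> xy; rewrite innerC xy scalar_conj0. Qed.

Lemma inner_rnorm x : inner x x = scalar_of k (rnorm x ^+ 2).
Proof. by rewrite innerxx rnormE !expr2 scalar_ofM. Qed.

Lemma pythagoras x y : inner x y = 0 -> rnorm (x + y) ^+ 2 = rnorm x ^+ 2 + rnorm y ^+ 2.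
Proof.
move=> xy; apply: (@scalar_of_inj _ k); rewrite scalar_ofD -!inner_rnorm.
by rewrite innerDl !innerDr xy (inner_orthC _ _ xy) addr0 add0r.
Qed.

Lemma parallelogram x y :
  rnorm (x + y) ^+ 2 + rnorm (x - y) ^+ 2 = 2 * (rnorm x ^+ 2 + rnorm y ^+ 2).
Proof.
rewrite mulr2n mulrDl mul1r.
apply: (@scalar_of_inj _ k); rewrite !scalar_ofD -!inner_rnorm.
by rewrite !innerDl !innerDr !innerNl !linearNr; ring.
Qed.

(** For v = 0 this is 0, since 0^-1 = 0; the identities below then still hold,
    so vanishing vectors need no separate treatment in Bessel's inequality. *)
Definition proj_coef h v : scalars R k := inner h v / inner v v.

Lemma proj_orth h v : inner (h - proj_coef h v *: v) v = 0.
Proof.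
rewrite innerBl innerZl; have [->|v0] := eqVneq v 0.
  by rewrite !inner0r mulr0 subrr.
rewrite divfK ?subrr// innerxx expf_neq0// normr_eq0; exact: v0.
Qed.

Lemma rnorm_proj h v :
  rnorm (h - proj_coef h v *: v) ^+ 2 =
    rnorm h ^+ 2 - rnorm (inner h v) ^+ 2 / rnorm v ^+ 2.
Proof.
have := @pythagoras (h - proj_coef h v *: v) (proj_coef h v *: v).
rewrite innerZr proj_orth mulr0 subrK => /(_ erefl) ->.
rewrite rnormZ /proj_coef rnormM rnormV inner_rnorm rnorm_scalar_of.
rewrite (ger0_norm (exprn_ge0 _ (rnorm_ge0 _))).
have [->|v0] := eqVneq (rnorm v) 0; last by field.
by rewrite expr0n /= invr0 !mulr0 expr0n/= subr0 addr0.
Qed.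

Lemma cauchy_schwarz x y : rnorm (inner x y) <= rnorm x * rnorm y.
Proof.
have [y0|y0] := eqVneq (rnorm y) 0.
  by rewrite (rnorm_eq0 y0) inner0r !rnorm0 mulr0.
have := exprn_ge0 2 (rnorm_ge0 (x - proj_coef x y *: y)).
rewrite rnorm_proj subr_ge0 ler_pdivrMr ?exprn_gt0 ?lt_neqAle ?rnorm_ge0 1?eq_sym ?y0//.
by rewrite -exprMn ler_sqr ?nnegrE ?mulr_ge0 ?rnorm_ge0.
Qed.

Definition orthogonal_on {I : eqType} (s : seq I) (v : I -> H) :=
  {in s &, forall i j, i != j -> inner (v i) (v j) = 0}.

(** Removing from h its projection on one vector lowers |h|^2 by the
    corresponding term and does not affect the inner products of h with the
    others. *)
Lemma bessel {I : eqType} (s : seq I) (v : I -> H) h : uniq s -> orthogonal_on s v ->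
  \sum_(i <- s) rnorm (inner h (v i)) ^+ 2 / rnorm (v i) ^+ 2 <= rnorm h ^+ 2.
Proof.
elim: s h => [|i s IH] h /=; first by rewrite big_nil exprn_ge0// rnorm_ge0.
move=> /andP[si us] vs; rewrite big_cons.
rewrite -lerBrDl -rnorm_proj.
apply: le_trans (IH (h - proj_coef h (v i) *: v i) us _); last first.
  by move=> j l js ls; apply: vs; rewrite inE ?js ?ls orbT.
rewrite big_seq [leRHS]big_seq; apply: ler_sum => j js.
rewrite innerBl innerZl vs ?mulr0 ?subr0 ?inE ?eqxx ?js ?orbT//.
by apply: contraNneq si => ->.
Qed.

Lemma pythagoras_sum {I : eqType} (s : seq I) (v : I -> H) :
  uniq s -> orthogonal_on s v ->
  rnorm (\sum_(i <- s) v i) ^+ 2 = \sum_(i <- s) rnorm (v i) ^+ 2.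
Proof.
elim: s => [|i s IH] /=; first by rewrite !big_nil rnorm0 expr0n.
move=> /andP[si us] vs; rewrite !big_cons pythagoras; last first.
  rewrite inner_sumr big_seq big1// => j js.
  by apply: vs; rewrite ?inE ?eqxx ?js ?orbT//; apply: contraNneq si => ->.
by rewrite IH// => j l js ls; apply: vs; rewrite inE ?js ?ls orbT.
Qed.

Lemma inner_inj x y : (forall z, inner z x = inner z y) -> x = y.
Proof.
move=> xy; apply/eqP; rewrite -subr_eq0; apply/eqP/(@rnorm_eq0 _ k)/eqP.
have : inner (x - y) (x - y) = 0 by rewrite innerBr xy subrr.
rewrite inner_rnorm -(scalar_of0 R k) => /scalar_of_inj /eqP.
by rewrite sqrf_eq0.
Qed.

End InnerProduct.

Section Completeness.
Context {R : realType} {k : scalar_kind} {V : completeNormedModType (scalars R k)}.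

Lemma rnorm_complete (u : nat -> V) :
  (forall e : R, 0 < e -> exists N, forall m n, (N <= m)%N -> (N <= n)%N ->
     rnorm (u m - u n) < e) ->
  exists z, forall e : R, 0 < e -> exists N, forall n, (N <= n)%N -> rnorm (u n - z) < e.
Proof.
move=> uC; have cu : cvg (u @ \oo).
  apply/cauchy_cvgP/cauchy_ballP => e e0.
  have re0 : 0 < scalar_re e by rewrite -(scalar_re0 R k); exact: scalar_re_lt.
  have [N NP] := uC _ re0.
  pose W := u @` [set n | (N <= n)%N].
  have uW : (u @ \oo) W by exists N => // n /= Nn; exists n.
  exists (W, W) => // -[_ _] /= [[m Nm <-] [n Nn <-]]; rewrite -ball_normE /ball_ /=.
  by rewrite -(ge0_scalar_reK (ltW e0)) lt_rnorm; exact: NP.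
exists (lim (u @ \oo)) => e e0.
have se0 : 0 < scalar_of k e by rewrite -(scalar_of0 R k) scalar_of_lt.
have /cvgrPdist_lt/(_ _ se0)[N _ NP] := cu.
by exists N => n Nn; rewrite -rnormN opprB -lt_rnorm; exact: NP.
Qed.

End Completeness.

Section Riesz.
Context {R : realType} {k : scalar_kind} {H : hilbertType R k}.

Lemma exists_invS_lt (e : R) : 0 < e -> exists N, forall n, (N <= n)%N -> n.+1%:R^-1 < e.
Proof.
move=> e0; have [N] := ltr_add_invr e0; rewrite add0r => Ne; exists N => n Nn.
by apply: le_lt_trans Ne; rewrite lef_pV2 ?posrE ?ltr0n// ler_nat.
Qed.

(** The functional f is represented by a multiple of the point z of least norm
    on the hyperplane f = 1. A minimizing sequence is Cauchy by the
    parallelogram identity; its limit is orthogonal to the kernel of f because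
    subtracting a projection on a vector of the kernel stays in the hyperplane
    and cannot lower the norm below the infimum. *)
Theorem riesz (f : H -> scalars R k) (M : R) :
  (forall a x y, f (a *: x + y) = a * f x + f y) ->
  (forall x, rnorm (f x) <= M * rnorm x) -> exists z, forall x, f x = inner x z.
Proof.
move=> fP fM.
have f0 : f 0 = 0 by have := fP (-1) 0 0; rewrite scaler0 addr0 mulN1r addNr.
have fZ a x : f (a *: x) = a * f x by rewrite -[a *: x]addr0 fP f0 addr0.
have fD x y : f (x + y) = f x + f y by rewrite -[x]scale1r fP scale1r mul1r.
have fB x y : f (x - y) = f x - f y by rewrite fD -scaleN1r fZ mulN1r.
have [[x0 fx0]|nf] := pselect (exists x, f x <> 0); last first.
  by exists 0 => x; rewrite inner0r; apply: contrapT => fx; apply: nf; exists x.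
pose S := [set rnorm x ^+ 2 | x in [set x | f x = 1]].
have infS : has_inf S.
  split; last by exists 0 => _ [x _ <-]; rewrite exprn_ge0// rnorm_ge0.
  exists (rnorm ((f x0)^-1 *: x0) ^+ 2), ((f x0)^-1 *: x0) => //=.
  by rewrite fZ mulVf//; exact/eqP.
set d := inf S.
have dS x : f x = 1 -> d <= rnorm x ^+ 2.
  by move=> fx; apply: ge_inf; [case: infS|exists x].
have /choice[u uP] n : exists x, f x = 1 /\ rnorm x ^+ 2 < d + n.+1%:R^-1.
  have [|_ [x fx <-] xd] := @inf_adherent _ S n.+1%:R^-1 _ infS; last by exists x.
  by rewrite invr_gt0.
have near_min m n : rnorm (u m - u n) ^+ 2 <= 2 * (m.+1%:R^-1 + n.+1%:R^-1).
  have [fm um] := uP m; have [fn un] := uP n.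
  have := parallelogram (u m) (u n).
  have h2 : scalar_of k (2^-1 : R) + scalar_of k 2^-1 = 1.
    by rewrite -scalar_ofD -scalar_of1; congr scalar_of; lra.
  have : d <= rnorm (scalar_of k 2^-1 *: (u m + u n)) ^+ 2.
    by apply: dS; rewrite fZ fD fm fn mulrDr mulr1.
  rewrite rnormZ rnorm_scalar_of ger0_norm ?invr_ge0// exprMn.
  rewrite [2^-1 ^+ 2](_ : _ = 1 / 4 :> R); last by field.
  move: um un; move: (m.+1%:R^-1) (n.+1%:R^-1) => gm gn.
  move: (rnorm (u m) ^+ 2) (rnorm (u n) ^+ 2) => a b.
  move: (rnorm (u m + u n) ^+ 2) (rnorm (u m - u n) ^+ 2) => c e um un dle par; lra.
have [z zP] : exists z, forall e : R, 0 < e ->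
    exists N, forall n, (N <= n)%N -> rnorm (u n - z) < e.
  apply: rnorm_complete => e e0.
  have e4 : 0 < e ^+ 2 / 4 by rewrite divr_gt0// exprn_gt0.
  have [N NP] := exists_invS_lt _ e4; exists N => m n /NP Nm /NP Nn.
  rewrite -ltr_sqr ?nnegrE ?rnorm_ge0 ?(ltW e0)//.
  apply: le_lt_trans (near_min m n) _.
  by move: (m.+1%:R^-1) (n.+1%:R^-1) Nm Nn => gm gn; lra.
have fz : f z = 1.
  apply/eqP; rewrite -subr_eq0; apply/eqP/(@rnorm_eq0 _ k)/eqP.
  rewrite eq_le rnorm_ge0 andbT; apply/ler_addgt0Pl => e e0; rewrite addr0.
  have M1 : 0 < `|M| + 1 by rewrite ltr_wpDl.
  have [N /(_ N (leqnn N)) /ltW NP] := zP (e / (`|M| + 1)) (divr_gt0 e0 M1).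
  have [fN _] := uP N; rewrite -fN -fB; apply: le_trans (fM _) _.
  rewrite -rnormN opprB; apply: (@le_trans _ _ ((`|M| + 1) * rnorm (u N - z))).
    by rewrite ler_wpM2r ?rnorm_ge0// ler_wpDr// ler_norm.
  by rewrite mulrC -ler_pdivlMr.
have orth w : f w = 0 -> inner z w = 0.
  move=> fw; apply/(@rnorm_eq0 _ k)/eqP.
  rewrite eq_le rnorm_ge0 andbT; apply/ler_addgt0Pl => e e0; rewrite addr0.
  have W0 : 0 < rnorm w + 1 by rewrite ltr_wpDl// rnorm_ge0.
  have e2 : 0 < e / 2 by rewrite divr_gt0.
  have [N1 h1] := zP _ (divr_gt0 e2 W0).
  have [N2 h2] := exists_invS_lt _ (divr_gt0 (exprn_gt0 2 e2) (exprn_gt0 2 W0)).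
  pose n := maxn N1 N2; have := h1 n (leq_maxl _ _); have := h2 n (leq_maxr _ _).
  have [fn un] := uP n; set g := n.+1%:R^-1 => gsmall nsmall.
  have : d <= rnorm (u n - proj_coef (u n) w *: w) ^+ 2.
    by apply: dS; rewrite fB fZ fw mulr0 subr0.
  rewrite rnorm_proj => dle.
  have unw : rnorm (inner (u n) w) <= e / 2.
    have [w0|w0] := eqVneq (rnorm w) 0.
      by rewrite (rnorm_eq0 w0) inner0r rnorm0 ltW// divr_gt0.
    have w2 : 0 < rnorm w ^+ 2 by rewrite exprn_gt0// lt_neqAle eq_sym w0 rnorm_ge0.
    rewrite -ler_sqr ?nnegrE ?rnorm_ge0 ?divr_ge0 ?(ltW e0)//.
    have : rnorm (inner (u n) w) ^+ 2 / rnorm w ^+ 2 <= g.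
      rewrite -(lerD2l d); apply: ltW; apply: le_lt_trans un.
      by rewrite addrC -lerBrDl.
    rewrite ler_pdivrMr// => /le_trans; apply.
    move: gsmall; rewrite ltr_pdivlMr ?exprn_gt0// => /ltW; apply: le_trans.
    rewrite ler_wpM2l ?invr_ge0 ?ler0n// ler_sqr ?nnegrE ?rnorm_ge0 ?(ltW W0)//.
    by rewrite lerDl.
  rewrite -[z](subKr (u n)) innerBl; apply: le_trans (rnormD _ _) _.
  rewrite rnormN [leRHS]splitr lerD//; apply: le_trans (cauchy_schwarz _ _) _.
  move: nsmall; rewrite ltr_pdivlMr// => /ltW; apply: le_trans.
  by rewrite ler_wpM2l ?rnorm_ge0// lerDl.
have z0 : inner z z != 0.
  apply/eqP; rewrite inner_rnorm -(scalar_of0 R k) => /scalar_of_inj/eqP.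
  rewrite sqrf_eq0 => /eqP /rnorm_eq0 zz; move: fz; rewrite zz f0.
  by move/esym/eqP; rewrite oner_eq0.
exists (scalar_conj (inner z z)^-1 *: z) => x.
rewrite innerZr scalar_conjK.
have : inner z (x - f x *: z) = 0 by apply: orth; rewrite fB fZ fz mulr1 subrr.
move/inner_orthC; rewrite innerBl innerZl => /eqP; rewrite subr_eq0 => /eqP ->.
by rewrite mulrCA mulVf// mulr1.
Qed.

End Riesz.

(** * Adjoints and rank-one operators *)

Section BoundedOperators.
Context {R : realType} {k : scalar_kind}.
Implicit Types (E F : normedModType (scalars R k)).

Lemma bounded_continuous {E F} {f : E -> F} {M : R} : linear f ->
  (forall x, rnorm (f x) <= M * rnorm x) -> continuous f.
Proof.
move=> fl fM x; have fB y : f x - f y = f (x - y).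
  by have := fl (-1) y x; rewrite !scaleN1r => fyx; rewrite [LHS]addrC -fyx addrC.
apply/(@cvgrPdist_lt _ _ _ (nbhs x)) => e e0.
have re0 : 0 < scalar_re e by rewrite -(scalar_re0 R k); exact: scalar_re_lt.
have M1 : 0 < `|M| + 1 by rewrite ltr_wpDl.
have d0 : 0 < scalar_of k (scalar_re e / (`|M| + 1)).
  by rewrite -(scalar_of0 R k) scalar_of_lt divr_gt0.
apply/nbhs_ballP; exists (scalar_of k (scalar_re e / (`|M| + 1))) => // y.
rewrite -ball_normE /ball_ /= fB lt_rnorm -(ge0_scalar_reK (ltW e0)) lt_rnorm => xy.
apply: le_lt_trans (fM _) _; apply: (@le_lt_trans _ _ ((`|M| + 1) * rnorm (x - y))).
  by rewrite ler_wpM2r ?rnorm_ge0// ler_wpDr// ler_norm.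
by move: xy; rewrite scalar_ofK => xy; rewrite mulrC -ltr_pdivlMr.
Qed.

Lemma exists_clinear {E F} {f : E -> F} {M : R} : linear f ->
  (forall x, rnorm (f x) <= M * rnorm x) -> exists S : clinear E F, forall x, S x = f x.
Proof. by move=> fl fM; exists (mk_clinear fl (bounded_continuous fl fM)). Qed.

End BoundedOperators.

Section Adjoint.
Context {R : realType} {k : scalar_kind} {H : hilbertType R k}.

(** [adjoint] picks an operator with this property if there is one, so the
    content is existence: the Riesz vector of x |-> <T x, y> depends linearly on
    y, with norm at most |T| |y|. *)
Lemma adjointP (T : clinear H H) x y : inner (T x) y = inner x (adjoint T y).
Proof.
have /(xgetPex (0 : clinear H H)) : exists S : clinear H H,
    forall x y, inner (T x) y = inner x (S y); last by rewrite /adjoint; apply.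
have /choice[f fP] : forall y, exists z, forall x, inner (T x) y = inner x z.
  move=> z; apply: (riesz _ (op_norm T * rnorm z)) => [a u v|u].
    by rewrite linearP innerDl innerZl.
  apply: le_trans (cauchy_schwarz _ _) _.
  by rewrite mulrAC ler_wpM2r ?rnorm_ge0// op_normP.
have fl : linear f.
  move=> a u v; apply: inner_inj => z.
  by rewrite -fP innerDr innerZr !fP -innerZr -innerDr.
have fM u : rnorm (f u) <= op_norm T * rnorm u.
  have [->|n0] := eqVneq (rnorm (f u)) 0.
    by rewrite mulr_ge0 ?op_norm_ge0 ?rnorm_ge0.
  have n1 : 0 < rnorm (f u) by rewrite lt_neqAle eq_sym n0 rnorm_ge0.
  rewrite -(ler_pM2l n1) -expr2.
  have -> : rnorm (f u) ^+ 2 = rnorm (inner (T (f u)) u).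
    by rewrite fP inner_rnorm rnorm_scalar_of ger0_norm// exprn_ge0// ltW.
  apply: le_trans (cauchy_schwarz _ _) _.
  by rewrite mulrA [_ * op_norm T]mulrC ler_wpM2r ?rnorm_ge0// op_normP.
have [S SP] := exists_clinear fl fM.
by exists S => u v; rewrite SP.
Qed.

End Adjoint.

Section RankOne.
Context {R : realType} {k : scalar_kind} {H : hilbertType R k}.
Implicit Types (u v h x y : H) (T : clinear H H).

Fact tensor_linear u v : linear (fun h => inner h v *: u).
Proof. by move=> a x y; rewrite innerDl innerZl scalerDl scalerA. Qed.

Fact tensor_bound u v h : rnorm (inner h v *: u) <= rnorm u * rnorm v * rnorm h.
Proof.
rewrite rnormZ mulrC -mulrA ler_wpM2l ?rnorm_ge0// mulrC.
exact: cauchy_schwarz.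
Qed.

(** The rank-one operator u ⊗ v = <., v> u. *)
Definition tensor u v : clinear H H :=
  mk_clinear (tensor_linear u v)
    (bounded_continuous (tensor_linear u v) (tensor_bound u v)).

Lemma tensorE u v h : tensor u v h = inner h v *: u. Proof. by []. Qed.

Lemma clinear_sumE (E F : topologicalLmodType (scalars R k)) (I : Type) (s : seq I)
    (P : pred I) (f : I -> clinear E F) (x : E) :
  (\sum_(i <- s | P i) f i) x = \sum_(i <- s | P i) f i x.
Proof. by elim/big_rec2: _ => // i y g _ <-. Qed.

Lemma tensorDl u1 u2 v : tensor (u1 + u2) v = tensor u1 v + tensor u2 v.
Proof. by apply: clinearP => h; rewrite tensorE scalerDr. Qed.

Lemma tensorDr u v1 v2 : tensor u (v1 + v2) = tensor u v1 + tensor u v2.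
Proof. by apply: clinearP => h; rewrite tensorE innerDr scalerDl. Qed.

Lemma tensorZl a u v : tensor (a *: u) v = a *: tensor u v.
Proof.
apply: clinearP => h; rewrite tensorE -[RHS]/(a *: tensor u v h) tensorE.
by rewrite !scalerA mulrC.
Qed.

Lemma tensorZr a u v : tensor u (a *: v) = scalar_conj a *: tensor u v.
Proof.
apply: clinearP => h; rewrite tensorE -[RHS]/(scalar_conj a *: tensor u v h) tensorE.
by rewrite scalerA innerZr.
Qed.

Lemma tensor_comp A B u v :
  clinear_comp A (clinear_comp (tensor u v) B) = tensor (A u) (adjoint B v).
Proof. by apply: clinearP => h; rewrite /= linearZ /= adjointP. Qed.

Lemma rank_lt_tensor u v : rank_lt (tensor u v) 2.
Proof.
apply/rank_ltP; exists 1%N => //; exists (fun=> u) => h.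
by exists (fun=> inner h v); rewrite big_ord1.
Qed.

Lemma rank_lt_sum_tensor (I : Type) (s : seq I) (u v : I -> H) :
  rank_lt (\sum_(i <- s) tensor (u i) (v i)) (size s).+1.
Proof.
elim: s => [|i s IH]; first by rewrite big_nil; exact: rank_lt0.
by rewrite big_cons; exact: (@rank_ltD _ _ _ _ _ 1 _ (rank_lt_tensor _ _) IH).
Qed.

(** By Pythagoras, the square of the image of h is the sum of the
    |<h, v_i>|^2 |u_i|^2, each at most m^2 |<h, v_i>|^2 / |v_i|^2; conclude by
    Bessel. *)
Lemma op_norm_orthogonal_sum (I : eqType) (s : seq I) (u v : I -> H) (m : R) :
  uniq s -> orthogonal_on s u -> orthogonal_on s v -> 0 <= m ->
  (forall i, i \in s -> rnorm (u i) * rnorm (v i) <= m) ->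
  op_norm (\sum_(i <- s) tensor (u i) (v i)) <= m.
Proof.
move=> us ou ov m0 uvm; apply: op_norm_le => // h.
rewrite -ler_sqr ?nnegrE ?mulr_ge0 ?rnorm_ge0// clinear_sumE.
rewrite (pythagoras_sum s) => //; last first.
  move=> i j si sj ij; rewrite !tensorE innerZl innerZr ou//.
  by rewrite !mulr0.
rewrite exprMn; apply: le_trans (ler_wpM2l _ (bessel s v h us ov)); last exact: exprn_ge0.
rewrite mulr_sumr big_seq [leRHS]big_seq; apply: ler_sum => i si.
rewrite tensorE rnormZ exprMn.
have [v0|v0] := eqVneq (rnorm (v i)) 0.
  by rewrite (rnorm_eq0 v0) inner0r !rnorm0 expr0n/= !mul0r mulr0.
have v1 : 0 < rnorm (v i) by rewrite lt_neqAle eq_sym v0 rnorm_ge0.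
rewrite [leRHS]mulrCA ler_wpM2l ?exprn_ge0 ?rnorm_ge0// ler_pdivlMr ?exprn_gt0//.
by rewrite -exprMn ler_sqr ?nnegrE ?mulr_ge0 ?rnorm_ge0// uvm.
Qed.

End RankOne.

(** * Schatten norms of orthogonal sums *)

Section PartialSums.
Context {R : realType} {k : scalar_kind} {E : normedModType (scalars R k)}.
Context (p : R) (p_gt0 : 0 < p).
Implicit Types (S T : clinear E E).

(** Reduces bounds on the Schatten norm to finite sums of real numbers. *)
Lemma schatten_norm_leP S (c : R) : 0 <= c ->
  (schatten_norm p S <= c%:E)%E <->
  (forall J, \sum_(0 <= j < J) approx_number j.+1 S `^ p <= c `^ p).
Proof.
move=> c0; rewrite /schatten_norm Lnorm_counting//.
under eq_eseriesr do rewrite abse_EFin ger0_norm ?approx_number_ge0// poweR_EFin.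
set X := (X in (X `^ _)%E).
have t0 j : (0 <= j)%N -> true -> (0 <= (approx_number j.+1 S `^ p)%:E)%E.
  by rewrite lee_fin powR_ge0.
have -> : (X `^ p^-1 <= c%:E)%E = (X <= (c `^ p)%:E)%E.
  have X0 : (0 <= X)%E by apply: nneseries_ge0 => j ? ?; exact: t0.
  have cE : c = (c `^ p) `^ p^-1 by rewrite -powRrM mulfV ?gt_eqF// powRr1.
  have ip0 : 0 < p^-1 by rewrite invr_gt0.
  move: X0; case: X => [x| |]//=; last by rewrite gt_eqF// !leye_eq.
  rewrite !lee_fin => x0; apply/idP/idP => h.
    have := @ge0_ler_powR _ p (ltW p_gt0) (x `^ p^-1) c.
    by rewrite !nnegrE powR_ge0 c0 -powRrM mulVf ?gt_eqF// powRr1//; apply.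
  by rewrite [leRHS]cE; apply: ge0_ler_powR; rewrite ?nnegrE ?powR_ge0// ltW.
split=> [Xc J|h].
  rewrite -lee_fin -sumEFin; apply: le_trans Xc.
  exact: (@nneseries_lim_ge _ _ xpredT).
apply: lime_le; first by apply: is_cvg_nneseries => j ? ?; exact: t0.
by apply: nearW => J; rewrite sumEFin lee_fin.
Qed.

Lemma op_norm_approx1 S : op_norm S <= approx_number 1 S.
Proof.
apply: le_approx_number => A /rank_ltP[d]; case: d => // _ [v Av].
suff -> : A = 0 by rewrite subr0.
by apply: clinearP => x; have [c ->] := Av x; rewrite big_ord0.
Qed.

Lemma approx_number_le_op_norm n S : approx_number n.+1 S <= op_norm S.
Proof.
by rewrite -[S in leRHS]subr0; apply: approx_number_le; exact: rank_lt0.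
Qed.

Lemma approx_number_perturb n S T :
  approx_number n.+1 S <= approx_number n.+1 T + op_norm (S - T).
Proof.
have := @approx_numberD _ _ _ _ n 0 T (S - T); rewrite addn0 addrC subrK.
move=> /le_trans; apply; rewrite lerD2l; exact: approx_number_le_op_norm.
Qed.

Lemma approx_number_finite_rank n (F : clinear E E) :
  rank_lt F n.+1 -> approx_number n.+1 F = 0 :> R.
Proof.
move=> Fn; apply/eqP; rewrite eq_le approx_number_ge0 andbT.
apply: le_trans (approx_number_le _ Fn) _; rewrite subrr.
by apply: op_norm_le => // x; rewrite rnorm0 mul0r.
Qed.

Lemma powR_le_cancel (a c : R) : 0 <= a -> 0 <= c -> a `^ p <= c `^ p -> a <= c.
Proof.
move=> a0 c0; apply: contraTT; rewrite -!ltNge => ca.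
by apply: gt0_ltr_powR; rewrite ?nnegrE.
Qed.

Lemma op_norm_le_schatten S (c : R) : 0 <= c -> (schatten_norm p S <= c%:E)%E ->
  op_norm S <= c.
Proof.
move=> c0 /(schatten_norm_leP S c c0)/(_ 1%N); rewrite big_nat1 => h.
apply: le_trans (op_norm_approx1 S) _.
by apply: powR_le_cancel h => //; exact: approx_number_ge0.
Qed.

End PartialSums.

Section OrthogonalSums.
Context {R : realType} {k : scalar_kind} {H : hilbertType R k}.
Context (p : R) (p_gt0 : 0 < p).

(** Order the terms by decreasing w_i = |u_i| |v_i|. Cutting the sum after j
    terms leaves an operator of norm at most the next w_i, which therefore
    bounds the (j+1)-st approximation number. *)
Lemma schatten_norm_orthogonal_sum (I : eqType) (s : seq I) (u v : I -> H) (c : R) :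
  uniq s -> orthogonal_on s u -> orthogonal_on s v -> 0 <= c ->
  \sum_(i <- s) (rnorm (u i) * rnorm (v i)) `^ p <= c `^ p ->
  (schatten_norm p (\sum_(i <- s) tensor (u i) (v i))%R <= c%:E)%E.
Proof.
move=> us ou ov c0; pose w i := rnorm (u i) * rnorm (v i).
have w0 i : 0 <= w i by rewrite mulr_ge0 ?rnorm_ge0.
pose r i j := w j <= w i; pose t := path.sort r s.
have st : perm_eq t s by rewrite perm_sort.
have mt : t =i s by exact: perm_mem.
rewrite -!(perm_big _ st) /= => sum_c; apply/schatten_norm_leP => // J.
apply: le_trans sum_c; pose g j := nth 0 (map w t) j.
have -> : \sum_(i <- t) (rnorm (u i) * rnorm (v i)) `^ p =
    \sum_(0 <= j < size t) g j `^ p.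
  by rewrite -(big_map w predT (fun x => x `^ p)) (big_nth 0) size_map.
have g0 j : 0 <= g j.
  have [jt|tj] := ltnP j (size t); last by rewrite /g nth_default// size_map.
  have /mapP[i _ wi] : nth 0 (map w t) j \in map w t by rewrite mem_nth// size_map.
  by rewrite /g wi.
have ag j : approx_number j.+1 (\sum_(i <- t) tensor (u i) (v i)) <= g j.
  rewrite -[t in leLHS](cat_take_drop j) big_cat /=.
  have rk : rank_lt (\sum_(i <- take j t) tensor (u i) (v i)) j.+1.
    have [d dj hd] := rank_lt_sum_tensor _ (take j t) u v.
    exists d => //; apply: leq_trans dj _; rewrite ltnS size_take.
    by case: ifP => // /negbT; rewrite -leqNgt.
  apply: le_trans (approx_number_le _ rk) _; rewrite addrAC subrr add0r.
  have sub : {subset drop j t <= s} by move=> i /mem_drop; rewrite mt.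
  apply: op_norm_orthogonal_sum; rewrite ?g0//.
  - by rewrite drop_uniq// sort_uniq.
  - by move=> i i' /sub si /sub si'; exact: ou.
  - by move=> i i' /sub si /sub si'; exact: ov.
  (* The copy x0 of i serves as a default value unaffected by rewriting i. *)
  move=> i ij; have x0 := i; have jt : (j < size t)%N.
    by rewrite ltnNge; apply: contraTN ij => /drop_oversize ->.
  have : path.sorted r (drop j t).
    by apply/drop_sorted/sort_sorted => i1 i2; exact: le_total.
  have r_trans : transitive r.
    by move=> i2 i1 i3; rewrite /r => /[swap]; exact: le_trans.
  move: ij; rewrite (drop_nth x0 jt) => ij /(order_path_min r_trans)/allP rj.
  rewrite /g (nth_map x0)//; move: ij; rewrite inE => /predU1P[->//|ij].
  by have := rj _ ij; rewrite /r.
apply: (@le_trans _ _ (\sum_(0 <= j < J) g j `^ p)).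
  apply: ler_sum => j _; apply: ge0_ler_powR; rewrite ?nnegrE ?g0 ?approx_number_ge0//.
  exact: ltW.
have g1 : \sum_(size t <= j < maxn J (size t)) g j `^ p = 0.
  rewrite big_nat_cond big1// => j /andP[/andP[tj _] _].
  by rewrite /g nth_default ?size_map// powR0// gt_eqF.
have -> : \sum_(0 <= j < size t) g j `^ p = \sum_(0 <= j < maxn J (size t)) g j `^ p.
  by rewrite [RHS](big_cat_nat _ (n := size t)) ?leq_maxr//= g1 addr0.
rewrite [leRHS](big_cat_nat _ (n := J)) ?leq_maxl//=.
by rewrite lerDl; apply: sumr_ge0 => j _; exact: powR_ge0.
Qed.

End OrthogonalSums.

(** * Completeness of the Schatten class *)

Section SchattenSpace.
Context {R : realType} {k : scalar_kind} {H : hilbertType R k}.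
Context {p : R} (p1 : 1 <= p).
Local Notation schatten := (@schatten R k H p p1).

Let p_gt0 : 0 < p. Proof. exact: lt_le_trans ltr01 p1. Qed.

Lemma schatten_nbhs0P (V : set schatten) : nbhs (0 : schatten) V <->
  exists2 e : R, 0 < e & forall T : schatten, (schatten_norm p T < e%:E)%E -> V T.
Proof.
split=> [/schatten_nbhsP[e e0 eV]|[e e0 eV]].
  by exists e => // T Te; apply: eV; rewrite subr0.
by apply/schatten_nbhsP; exists e => // T; rewrite subr0; exact: eV.
Qed.

Lemma schatten_halving_base : exists U : nat -> set schatten, halving_base U.
Proof.
have /choice[d dP] : forall e : R, exists d : R, 0 < e -> 0 < d /\
    forall S T : clinear H H, (schatten_norm p S < d%:E)%E ->
      (schatten_norm p T < d%:E)%E -> (schatten_norm p (S + T)%R < e%:E)%E.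
  move=> e; have [e0|_] := ltP 0 e; last by exists 0.
  by have [d d0 dP] := schatten_normD_near0 H p_gt0 e0; exists d.
pose e := fix e (n : nat) : R := if n is m.+1 then Num.min (d (e m)) n.+1%:R^-1 else 1.
have e0 j : 0 < e j by elim: j => //= j IH; rewrite lt_min invr_gt0 ltr0n (dP _ IH).1.
exists (fun j => [set T : schatten | (schatten_norm p T < (e j)%:E)%E]); split.
- by move=> j; apply/schatten_nbhs0P; exists (e j).
- move=> V /schatten_nbhs0P[r r0 rV]; have [N NP] := exists_invS_lt _ r0.
  exists N.+1 => T /= TN; apply: rV; apply: lt_trans TN _.
  by rewrite lte_fin gt_min NP ?orbT.
move=> j S T /= Se Te; apply: (dP _ (e0 j)).2.
  by apply: lt_le_trans Se _; rewrite lee_fin ge_min lexx.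
by apply: lt_le_trans Te _; rewrite lee_fin ge_min lexx.
Qed.

Lemma op_norm_limit (E F : normedModType (scalars R k)) (u : nat -> clinear E F)
    (f : E -> F) :
  (forall e : R, 0 < e -> exists N, forall n x, (N <= n)%N ->
     rnorm (u n x - f x) <= e * rnorm x) ->
  exists2 S : clinear E F, forall x, S x = f x &
    forall e : R, 0 < e -> exists N, forall n, (N <= n)%N -> op_norm (S - u n) <= e.
Proof.
move=> uf; have fl : linear f.
  move=> a x y; apply/eqP; rewrite -subr_eq0; apply/eqP/(@rnorm_eq0 _ k)/eqP.
  rewrite eq_le rnorm_ge0 andbT; apply/ler_addgt0Pl => e e0; rewrite addr0.
  pose c := rnorm (a *: x + y) + rnorm (a : scalars R k) * rnorm x + rnorm y + 1.
  have c0 : 0 < c by rewrite ltr_wpDl// !addr_ge0 ?mulr_ge0 ?rnorm_ge0.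
  have [N /(_ N)] := uf _ (divr_gt0 e0 c0); set r := e / c => h.
  have -> : f (a *: x + y) - (a *: f x + f y) =
      - (u N (a *: x + y) - f (a *: x + y)) + (a *: (u N x - f x) + (u N y - f y)).
    by rewrite (linearP (u N)) scalerBr opprB [X in _ = _ + X]addrACA -opprD addrA subrK.
  have hN z : rnorm (u N z - f z) <= r * rnorm z by exact: h.
  apply: le_trans (rnormD _ _) _; rewrite rnormN.
  apply: le_trans (lerD (hN _) (rnormD _ _)) _; rewrite rnormZ.
  apply: le_trans (lerD (lexx _) (lerD (ler_wpM2l (rnorm_ge0 _) (hN _)) (hN _))) _.
  have -> : e = r * c by rewrite divfK// gt_eqF.
  have r0 : 0 < r by rewrite divr_gt0.
  rewrite [_ * (r * _)]mulrCA -!mulrDr ler_wpM2l ?(ltW r0)//.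
  by rewrite addrA lerDl.
have [N1 h1] := uf 1 ltr01.
have fM x : rnorm (f x) <= (op_norm (u N1) + 1) * rnorm x.
  rewrite -[f x](subrK (u N1 x)) addrC mulrDl; apply: le_trans (rnormD _ _) _.
  by rewrite lerD ?op_normP// -rnormN opprB h1.
have [S SP] := exists_clinear fl fM; exists S => // e e0.
have [N hN] := uf e e0; exists N => n Nn; apply: op_norm_le => [|x]; first exact: ltW.
by rewrite -[(S - u n) x]/(S x - u n x) SP -rnormN opprB; exact: hN.
Qed.

(** The operator norm is the first approximation number, so a Cauchy sequence
    u has a limit S in operator norm. For the Schatten norm, a finite number J
    of approximation numbers of S - u n exceed those of u m - u n by as little
    as desired when m is large, so the Cauchy bound for the latter passes to
    S - u n, up to a constant factor and uniformly in J. *)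
Lemma schatten_seq_complete : @seq_complete (scalars R k) schatten.
Proof.
move=> u uC.
have uC' (e : R) : 0 < e -> exists N, forall m n, (N <= m)%N -> (m <= n)%N ->
    (schatten_norm p (val (u n) - val (u m))%R <= e%:E)%E.
  move=> e0; have [|N NP] := uC [set T : schatten | (schatten_norm p T < e%:E)%E].
    by apply/schatten_nbhs0P; exists e.
  by exists N => m n Nm mn; apply: ltW; exact: NP.
have uop (e : R) : 0 < e -> exists N, forall m n x, (N <= m)%N -> (N <= n)%N ->
    rnorm (u m x - u n x) <= e * rnorm x.
  move=> e0; have [N NP] := uC' e e0; exists N.
  have le_case m n x : (N <= m)%N -> (m <= n)%N -> rnorm (u n x - u m x) <= e * rnorm x.
    move=> Nm mn; have := op_norm_le_schatten _ p_gt0 _ _ (ltW e0) (NP _ _ Nm mn).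
    move=> h; apply: le_trans (op_normP (val (u n) - val (u m)) x) _.
    by rewrite ler_wpM2r ?rnorm_ge0.
  move=> m n x Nm Nn; case: (leqP n m) => [nm|/ltnW mn]; first exact: le_case.
  by rewrite -rnormN opprB le_case.
have /choice[f fP] : forall x, exists z, forall e : R, 0 < e ->
    exists N, forall n, (N <= n)%N -> rnorm (u n x - z) < e.
  move=> x; apply: rnorm_complete => e e0.
  have c0 : 0 < rnorm x + 1 by rewrite ltr_wpDl ?rnorm_ge0.
  have [N NP] := uop _ (divr_gt0 e0 c0); exists N => m n Nm Nn.
  apply: le_lt_trans (NP m n x Nm Nn) _; rewrite mulrAC ltr_pdivrMr//.
  by rewrite ltr_pM2l// ltrDl.
have uf (e : R) : 0 < e -> exists N, forall n x, (N <= n)%N ->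
    rnorm (u n x - f x) <= e * rnorm x.
  move=> e0; have [N NP] := uop e e0; exists N => n x Nn.
  apply/ler_addgt0Pl => d d0; have [M MP] := fP x d d0.
  rewrite -[u n x](subrK (u (maxn N M) x)) -addrA; apply: le_trans (rnormD _ _) _.
  rewrite [leLHS]addrC lerD//; first by apply/ltW/MP/leq_maxr.
  by apply: NP => //; exact: leq_maxl.
have [S SP Slim] := op_norm_limit _ _ (fun n => val (u n)) f uf.
have Sclose (e : R) : 0 < e -> exists N, forall n, (N <= n)%N ->
    (schatten_norm p (S - val (u n))%R <= (4 * e)%:E)%E.
  move=> e0; have [N NP] := uC' e e0; exists N => n Nn.
  have e40 : 0 <= 4 * e by rewrite mulr_ge0// ltW.
  apply/schatten_norm_leP => // J.
  (* The radius d is small enough for J copies of d^p to add up to at most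
     e^p. *)
  pose d := (e `^ p / J.+1%:R) `^ p^-1.
  have ep0 : 0 < e `^ p by rewrite powR_gt0.
  have d0 : 0 < d by rewrite powR_gt0// divr_gt0.
  have dp : d `^ p = e `^ p / J.+1%:R.
    by rewrite -powRrM mulVf ?gt_eqF// powRr1// divr_ge0 ?ltW.
  have [M MP] := Slim _ d0; pose m := maxn n M.
  have /(schatten_norm_leP _ p_gt0 _ _ (ltW e0))/(_ J) := NP n m Nn (leq_maxl _ _) => um.
  have Sm := MP m (leq_maxr _ _).
  have term j : approx_number j.+1 (S - val (u n)) `^ p <=
      2 `^ p * (approx_number j.+1 (val (u m) - val (u n)) `^ p + d `^ p).
    apply: le_trans (powRD_le p_gt0 (approx_number_ge0 _ _) (ltW d0)).
    apply: ge0_ler_powR; rewrite ?nnegrE ?addr_ge0 ?approx_number_ge0 ?(ltW p_gt0) ?(ltW d0)//.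
    apply: le_trans (approx_number_perturb _ _ (val (u m) - val (u n))) _.
    by rewrite lerD2l opprB addrA subrK.
  apply: le_trans (ler_sum _ (fun j _ => term j)) _.
  rewrite -mulr_sumr big_split /= sumr_const_nat subn0 dp.
  have -> : (4 : R) = 2 * 2 by rewrite -natrM.
  rewrite -mulrA powRM ?mulr_ge0 ?(ltW e0)//= ler_wpM2l ?powR_ge0//.
  rewrite powRM ?(ltW e0)//; apply: (@le_trans _ _ (e `^ p + e `^ p)).
    rewrite lerD// -[_ *+ J]mulr_natr mulrAC ler_pdivrMr ?ltr0n// ler_wpM2l ?(ltW ep0)//.
    by rewrite ler_nat.
  rewrite [leLHS](_ : _ = 2 * e `^ p); last by rewrite mulr2n mulrDl mul1r.
  rewrite ler_wpM2r ?(ltW ep0)//.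
  by rewrite -[leLHS]powRr1// ler_powR// ler1n.
have Soo : (schatten_norm p S < +oo)%E.
  have [N /(_ N (leqnn N)) SN] := Sclose 1 ltr01.
  rewrite -(subrK (val (u N)) S); apply: schatten_normD_lty => //.
    by apply: le_lt_trans SN _; rewrite ltry.
  exact: schatten_lty.
have Smem : S \in schatten_pred p1 by rewrite inE.
exists (Schatten Smem) => V /schatten_nbhsP[e e0 eV].
have [|N NP] := Sclose (e / 8); first by rewrite divr_gt0.
exists N => // n /= Nn; apply: eV; rewrite -schatten_normN// opprB /=.
apply: le_lt_trans (NP n Nn) _; rewrite lte_fin; lra.
Qed.

End SchattenSpace.

(** * Density of sums of rank-one operators *)

Lemma small_tail {R : realType} (a : nat -> R) (C : R) : (forall j, 0 <= a j) ->
  (forall J, \sum_(0 <= j < J) a j <= C) ->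
  forall e, 0 < e -> exists n, forall J, \sum_(0 <= i < J) a (n + i)%N <= e.
Proof.
move=> a0 aC e e0; pose S := range (fun J => \sum_(0 <= j < J) a j).
have supS : has_sup S.
  by split; [exists (\sum_(0 <= j < 0) a j), 0%N|exists C => _ [J _ <-]].
have [_ [n _ <-] ne] := sup_adherent e0 supS; exists n => J.
have : \sum_(0 <= j < n + J) a j <= sup S.
  by apply: sup_upper_bound => //; exists (n + J)%N.
rewrite (big_cat_nat _ (n := n)) ?leq_addr//= -{2}[n]add0n big_addn addKn.
under [X in _ + X]eq_bigr do rewrite addnC.
lra.
Qed.

Section FiniteRank.
Context {R : realType} {k : scalar_kind} {H : hilbertType R k}.

(** Split off the component of F along one spanning vector v0: it is the
    rank-one operator (v0 / |v0|^2) ⊗ F* v0, and the rest has its range in the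
    span of the projections of the other vectors orthogonally to v0. *)
Lemma finite_rank_sum_tensor d (v : 'I_d -> H) (F : clinear H H) :
  (forall x, exists c : 'I_d -> scalars R k, F x = \sum_i c i *: v i) ->
  exists s : seq (H * H), F = \sum_(uv <- s) tensor uv.1 uv.2.
Proof.
elim: d v F => [|d IH] v F Fv.
  exists [::]; apply: clinearP => x; rewrite big_nil.
  by have [c ->] := Fv x; rewrite big_ord0.
pose v0 := v ord0; pose P y := y - proj_coef y v0 *: v0.
have PE y : proj_coef y v0 *: v0 = inner y v0 *: ((inner v0 v0)^-1 *: v0).
  by rewrite scalerA.
have P0 : P v0 = 0.
  rewrite /P /proj_coef; have [->|n0] := eqVneq v0 0; first by rewrite scaler0 subrr.
  by rewrite divff ?scale1r ?subrr// innerxx expf_neq0// normr_eq0.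
have Psum (c : 'I_d.+1 -> scalars R k) :
    P (\sum_i c i *: v i) = \sum_(i < d) c (lift ord0 i) *: P (v (lift ord0 i)).
  have -> : \sum_(i < d) c (lift ord0 i) *: P (v (lift ord0 i)) = \sum_i c i *: P (v i).
    by rewrite [RHS]big_ord_recl -/v0 P0 scaler0 add0r.
  rewrite /P PE inner_suml scaler_suml -sumrB; apply: eq_bigr => i _.
  by rewrite scalerBr PE innerZl !scalerA.
pose t := tensor ((inner v0 v0)^-1 *: v0) (adjoint F v0).
have [|s sE] := IH (fun i => P (v (lift ord0 i))) (F - t).
  move=> x; have [c Fx] := Fv x; exists (fun i => c (lift ord0 i)).
  by rewrite -Psum -Fx /P PE adjointP.
exists (((inner v0 v0)^-1 *: v0, adjoint F v0) :: s).
by rewrite big_cons -sE addrC subrK.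
Qed.

Context {p : R} (p1 : 1 <= p).
Let p_gt0 : 0 < p. Proof. exact: lt_le_trans ltr01 p1. Qed.

Lemma approx_number_adherent n (S : clinear H H) (d : R) : 0 < d ->
  exists2 A, rank_lt A n.+1 & op_norm (S - A) <= approx_number n.+1 S + d.
Proof.
move=> d0; apply: contrapT => h.
have : approx_number n.+1 S + d <= approx_number n.+1 S.
  apply: le_approx_number => A An; apply: ltW; rewrite ltNge; apply/negP => SA.
  by apply: h; exists A.
by rewrite gerDl leNgt d0.
Qed.

(** Let s_j be the approximation numbers of S, with j from 0, and let F have
    rank at most 2n with |S - F| ~ s_2n. The first 4n approximation numbers of
    S - F are at most about s_2n, and n s_2n^p is at most the sum of s_j^p over
    n <= j < 2n. The following ones are bounded by s_j at j + 2n, since F has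
    rank at most 2n. Both contributions are controlled by the tail of
    sum s_j^p from n on. *)
Lemma finite_rank_dense (S : schatten H p1) (e : R) : 0 < e ->
  exists n (F : clinear H H), rank_lt F n /\ (schatten_norm p (val S - F)%R < e%:E)%E.
Proof.
move=> e0; pose c := e / 2; have c0 : 0 < c by rewrite divr_gt0.
pose a j := approx_number j.+1 (val S) `^ p.
have a0 j : 0 <= a j by exact: powR_ge0.
have aC : exists C, forall J, \sum_(0 <= j < J) a j <= C.
  have [C [C0 SC]] : exists C, 0 <= C /\ (schatten_norm p (val S) <= C%:E)%E.
    have := schatten_lty S; have := schatten_norm_ge0 p (val S).
    by case: (schatten_norm _ _) => // r r0 _; exists r; split.
  by exists (C `^ p); exact/(schatten_norm_leP _ p_gt0 _ _ C0).
(* With tails below r, the first part is at most 2^p (4 r + r) and the second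
   at most r. *)
pose K : R := 5 * 2 `^ p + 1.
have K0 : 0 < K by rewrite ltr_wpDl// mulr_ge0// powR_ge0.
have cp0 : 0 < c `^ p by rewrite powR_gt0.
pose r := c `^ p / K; have r0 : 0 < r by rewrite divr_gt0.
have [C {}aC] := aC; have [n nP] := small_tail a C a0 aC r r0.
pose N := (n + n)%N.
pose d := (r / (N + N).+1%:R) `^ p^-1.
have d0 : 0 < d by rewrite powR_gt0// divr_gt0.
have dp : d `^ p = r / (N + N).+1%:R.
  by rewrite -powRrM mulVf ?gt_eqF// powRr1// divr_ge0// ltW.
have [F FN SF] := approx_number_adherent N (val S) d d0.
exists N.+1, F; split=> //.
apply: (@le_lt_trans _ _ c%:E); last by rewrite lte_fin /c; lra.
apply/schatten_norm_leP => //; first exact: ltW.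
move=> J; set f := (X in \sum_(_ <= j < _) X j).
have f0 j : 0 <= f j by exact: powR_ge0.
apply: (@le_trans _ _ (\sum_(0 <= j < (N + N) + J) f j)).
  rewrite [leRHS](big_cat_nat _ (n := J)) ?leq_addl//= lerDl.
  by apply: sumr_ge0 => j _.
rewrite (big_cat_nat _ (n := N + N)) ?leq_addr//=.
have -> : c `^ p = 5 * 2 `^ p * r + r.
  by rewrite -[X in _ + X]mul1r -mulrDl -/K mulrC divfK// gt_eqF.
apply: lerD; last first.
  rewrite -{1}[(N + N)%N]add0n big_addn addKn; apply: le_trans (nP J).
  apply: ler_sum => j _; apply: ge0_ler_powR; rewrite ?nnegrE ?approx_number_ge0 ?(ltW p_gt0)//.
  apply: (@le_trans _ _ (approx_number (j + N).+1 (val S))); last first.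
    by apply: approx_number_mono; rewrite /N; lia.
  have := approx_numberD (j + N) N (val S) (- F).
  rewrite (approx_number_finite_rank _ (- F)); last first.
    by rewrite -scaleN1r; exact: rank_ltZ.
  by rewrite addr0 addnA.
have fle j : f j <= 2 `^ p * (a N + d `^ p).
  apply: le_trans (powRD_le p_gt0 (approx_number_ge0 _ _) (ltW d0)).
  apply: ge0_ler_powR; rewrite ?nnegrE ?addr_ge0 ?approx_number_ge0 ?(ltW p_gt0) ?(ltW d0)//.
  exact: le_trans (approx_number_le_op_norm _ _) SF.
apply: le_trans (ler_sum _ (fun j _ => fle j)) _.
rewrite sumr_const_nat subn0 -[leLHS]mulr_natl [leLHS]mulrCA.
have -> : 5 * 2 `^ p * r = 2 `^ p * (5 * r) by rewrite mulrAC mulrC.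
rewrite ler_wpM2l ?powR_ge0// mulrDr.
have na : n%:R * a N <= r.
  apply: le_trans (nP n); rewrite mulr_natl -[X in _ *+ X]subn0 -sumr_const_nat.
  rewrite big_seq [leRHS]big_seq; apply: ler_sum => j; rewrite mem_index_iota => jn.
  apply: ge0_ler_powR; rewrite ?nnegrE ?approx_number_ge0 ?(ltW p_gt0)//.
  by apply: approx_number_mono; rewrite /N; lia.
have nd : (N + N)%:R * d `^ p <= r.
  rewrite dp mulrCA -[leRHS]mulr1 ler_wpM2l ?(ltW r0)//.
  by rewrite ler_pdivrMr ?ltr0n// mul1r ler_nat.
have -> : (N + N)%:R * a N = 4 * (n%:R * a N) by rewrite /N !natrD; ring.
by move: na nd; move: (n%:R * a N) ((N + N)%:R * d `^ p) => x y; lra.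
Qed.

End FiniteRank.

Section Approximation.
Context {R : realType} {k : scalar_kind} {H : hilbertType R k}.
Context {p : R} (p1 : 1 <= p).
Let p_gt0 : 0 < p. Proof. exact: lt_le_trans ltr01 p1. Qed.

Lemma schatten_norm_tensor (u v : H) :
  (schatten_norm p (tensor u v) <= (rnorm u * rnorm v)%:E)%E.
Proof.
have := @schatten_norm_orthogonal_sum _ _ _ p p_gt0 _ [:: tt] (fun=> u) (fun=> v)
  (rnorm u * rnorm v); rewrite !big_seq1.
by apply; rewrite ?mulr_ge0 ?rnorm_ge0// => -[] [] _ _; rewrite eqxx.
Qed.

Definition dense_family {I : Type} (z : I -> H) :=
  forall x e, 0 < e -> exists i, rnorm (x - z i) < e.

(** u ⊗ v depends continuously on u and v in Schatten norm, so u and v may be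
    replaced by members of the families, which are dense as sets: hence the
    sums without coefficients. *)
Lemma sum_tensor_dense {I J : Type} (z1 : I -> H) (z2 : J -> H) :
  dense_family z1 -> dense_family z2 ->
  forall (S : schatten H p1) (e : R), 0 < e -> exists s : seq (I * J),
    (schatten_norm p (val S - \sum_(i <- s) tensor (z1 i.1) (z2 i.2))%R < e%:E)%E.
Proof.
move=> z1d z2d.
pose Z s : clinear H H := \sum_(i <- s) tensor (z1 i.1) (z2 i.2).
pose approx S := forall e : R, 0 < e -> exists s, (schatten_norm p (S - Z s)%R < e%:E)%E.
have approxD S T : approx S -> approx T -> approx (S + T).
  move=> aS aT e e0; have [d d0 dP] := schatten_normD_near0 H p_gt0 e0.
  have [s sP] := aS d d0; have [t tP] := aT d d0; exists (s ++ t).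
  by rewrite /Z big_cat opprD addrACA; exact: dP.
have approx_tensor u v : approx (tensor u v).
  move=> e e0; have [d d0 dP] := schatten_normD_near0 H p_gt0 e0.
  have v1 : 0 < rnorm v + 1 by rewrite ltr_wpDl ?rnorm_ge0.
  have [i iP] := z1d u _ (divr_gt0 d0 v1).
  have z1i : 0 < rnorm (z1 i) + 1 by rewrite ltr_wpDl ?rnorm_ge0.
  have [j jP] := z2d v _ (divr_gt0 d0 z1i).
  exists [:: (i, j)]; rewrite /Z big_seq1 /=.
  have -> : tensor u v - tensor (z1 i) (z2 j) =
      tensor (u - z1 i) v + tensor (z1 i) (v - z2 j).
    have -> : tensor (z1 i) (v - z2 j) = tensor (z1 i) v - tensor (z1 i) (z2 j).
      by apply: clinearP => h; rewrite [LHS]tensorE innerBr scalerBl.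
    by rewrite addrA -tensorDl subrK.
  apply: dP; apply: le_lt_trans (schatten_norm_tensor _ _) _; rewrite lte_fin.
    apply: (@le_lt_trans _ _ (rnorm (u - z1 i) * (rnorm v + 1))).
      by rewrite ler_wpM2l ?rnorm_ge0// lerDl.
    by rewrite -ltr_pdivlMr.
  apply: (@le_lt_trans _ _ ((rnorm (z1 i) + 1) * rnorm (v - z2 j))).
    by rewrite ler_wpM2r ?rnorm_ge0// lerDl.
  by rewrite mulrC -ltr_pdivlMr.
have approx0 : approx 0.
  by move=> e e0; exists [::]; rewrite /Z big_nil subr0 schatten_norm0.
have approx_finite (F : clinear H H) n : rank_lt F n -> approx F.
  move=> /rank_ltP[d _ [v /finite_rank_sum_tensor[s ->]]].
  elim: s => [|uv s IH]; first by rewrite big_nil.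
  by rewrite big_cons; exact: approxD.
move=> S e e0; have [d d0 dP] := schatten_normD_near0 H p_gt0 e0.
have [n [F [/approx_finite aF SF]]] := finite_rank_dense p1 S d d0.
have [s sP] := aF d d0; exists s.
by rewrite -[val S](subrK F) -addrA; exact: dP.
Qed.

End Approximation.

(** * Orbits of rank-one operators *)

Lemma finite_sum_le_series {R : realType} (P : pred nat) (f : nat -> R) N (s : seq nat) :
  (forall n, 0 <= f n) -> uniq s -> all (fun n => (N <= n)%N && P n) s ->
  ((\sum_(n <- s) f n)%:E <= \sum_(N <= n <oo | P n) (f n)%:E)%E.
Proof.
move=> f0 us /allP hs; pose K := (\max_(n <- s) n).+1.
apply: (@le_trans _ _ (\sum_(N <= n < K | P n) (f n)%:E)%E); last first.
  by apply: (@nneseries_lim_ge _ _ P) => n _ _; rewrite lee_fin.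
rewrite sumEFin lee_fin.
have st : perm_eq s [seq n <- index_iota N K | n \in s].
  apply: uniq_perm => //; first by rewrite filter_uniq// iota_uniq.
  move=> n; rewrite mem_filter mem_index_iota; case: (boolP (n \in s)) => //= sn.
  have /andP[-> _] := hs n sn; rewrite /K ltnS /=.
  by rewrite (big_rem n)//= leq_maxl.
rewrite (perm_big _ st) big_filter big_mkcond [leRHS]big_mkcond /=.
apply: ler_sum => n _; case: ifP => [/hs /andP[_ ->]//|_].
by case: ifP.
Qed.

(** Each point of a countable dense set of H is approximated to within each
    1 / (j+1) by an element of the span. *)
Lemma separable_dense_span {R : realType} {k : scalar_kind} {H : hilbertType R k}
    (D : set H) : separable H -> dense (lin_span D) ->
  exists z : nat * nat -> H, (forall i, lin_span D (z i)) /\ dense_family z.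
Proof.
have meets (A : set H) x (e : R) : dense A -> 0 < e -> exists2 y, A y & rnorm (x - y) < e.
  move=> Ad e0; pose B := [set y | `|x - y| < scalar_of k e].
  have xB : nbhs x B.
    apply/nbhs_ballP; exists (scalar_of k e) => /=.
      by rewrite -(scalar_of0 R k) scalar_of_lt.
    by move=> y; rewrite -ball_normE.
  have [|y [By Ay]] := Ad B^° _ (@open_interior _ B); first by exists x.
  by exists y => //; rewrite -lt_rnorm; exact: (interior_subset By).
move=> [C Ccount Cd] Dd.
have [h hC] : exists h : nat -> H, C `<=` range h.
  have /pfcard_geP[->|[f]] := Ccount; first by exists (fun=> 0) => x [].
  by exists f => x /(@surj _ _ _ _ f) [n _ <-]; exists n.
have /choice[z zP] : forall ij : nat * nat, exists z,
    lin_span D z /\ rnorm (h ij.1 - z) < ij.2.+1%:R^-1.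
  move=> ij; have [|z Dz hz] := meets _ (h ij.1) ij.2.+1%:R^-1 Dd; last by exists z.
  by rewrite invr_gt0 ltr0n.
exists z; split=> [i|x e e0]; first by have [] := zP i.
have e2 : 0 < e / 2 by rewrite divr_gt0.
have [_ /hC[i _ <-] xi] := meets C x _ Cd e2.
have [j jP] := exists_invS_lt _ e2; exists (i, j).
have [_ /= hz] := zP (i, j).
rewrite -[x](subrK (h i)) -addrA; apply: le_lt_trans (rnormD _ _) _.
rewrite [e]splitr ltrD//; exact: lt_trans hz (jP _ (leqnn _)).
Qed.

Section TensorOrbits.
Context {R : realType} {k : scalar_kind} {H : hilbertType R k}.
Context {p : R} (p1 : 1 <= p).
Let p_gt0 : 0 < p. Proof. exact: lt_le_trans ltr01 p1. Qed.

Fact tensor_schatten (u v : H) : tensor u v \in schatten_pred p1.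
Proof.
rewrite inE /=; apply: le_lt_trans (schatten_norm_tensor p1 u v) _.
exact: ltry.
Qed.

Definition schatten_tensor (u v : H) : schatten H p1 := Schatten (tensor_schatten u v).

Lemma val_sum_schatten_tensor (I : Type) (s : seq I) (u v : I -> H) :
  val (\sum_(i <- s) schatten_tensor (u i) (v i)) = \sum_(i <- s) tensor (u i) (v i).
Proof. by elim/big_rec2: _ => // i y x _ <-. Qed.

Lemma schatten_tensorDl u1 u2 v :
  schatten_tensor (u1 + u2) v = schatten_tensor u1 v + schatten_tensor u2 v.
Proof. by apply: val_inj; exact: tensorDl. Qed.

Lemma schatten_tensorDr u v1 v2 :
  schatten_tensor u (v1 + v2) = schatten_tensor u v1 + schatten_tensor u v2.
Proof. by apply: val_inj; exact: tensorDr. Qed.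

Lemma schatten_tensorZl a u v : schatten_tensor (a *: u) v = a *: schatten_tensor u v.
Proof. by apply: val_inj; exact: tensorZl. Qed.

Lemma schatten_tensorZr a u v :
  schatten_tensor u (a *: v) = scalar_conj a *: schatten_tensor u v.
Proof. by apply: val_inj; exact: tensorZr. Qed.

Context (A T : clinear H H) (q : nat) (q_gt0 : (0 < q)%N).

Lemma iter_two_sided_mul n u v :
  iter n (two_sided_mul p1 A T) (schatten_tensor u v) =
  schatten_tensor (iter n A u) (iter n (adjoint T) v).
Proof.
elim: n => // n IH; rewrite !iterS IH; apply: val_inj.
exact: tensor_comp.
Qed.

Local Notation good := (summable_orbits (two_sided_mul p1 A T) q).

(** Orthogonality bounds the p-th power of the Schatten norm of a finite sum by
    the corresponding part of the numerical series. *)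
Lemma small_tails_schatten_tensor (P : nat -> pred nat) (u v : nat -> nat -> H) :
  (forall r, {in P r &, forall m n, m != n ->
     inner (u r m) (u r n) = 0 /\ inner (v r m) (v r n) = 0}) ->
  uniformly_summable (fun r n => (0 < n)%N && P r n)
    (fun r n => rnorm (u r n) `^ p * rnorm (v r n) `^ p) ->
  small_tails P (fun r n => schatten_tensor (u r n) (v r n)).
Proof.
move=> orth usum V /schatten_nbhs0P[e e0 eV].
have e2 : 0 < e / 2 by rewrite divr_gt0.
have [|N NP] := usum ((e / 2) `^ p); first by rewrite powR_gt0.
exists (maxn N 1) => r s us /allP hs; apply: eV; rewrite val_sum_schatten_tensor.
have sP n : n \in s -> P r n by move=> /hs /andP[].
apply: (@le_lt_trans _ _ (e / 2)%:E); last by rewrite lte_fin; lra.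
apply: schatten_norm_orthogonal_sum => //; last first.
- rewrite -lee_fin; apply: le_trans (ltW (NP r)).
  under eq_bigr do rewrite powRM ?rnorm_ge0//.
  apply: finite_sum_le_series => //.
    by move=> n; rewrite mulr_ge0 ?powR_ge0.
  by apply/allP => n /hs; rewrite geq_max -!andbA.
- exact: ltW.
- by move=> m n /sP Pm /sP Pn mn; exact: (orth r m n Pm Pn mn).2.
- by move=> m n /sP Pm /sP Pn mn; exact: (orth r m n Pm Pn mn).1.
Qed.

(** The preimages of x ⊗ y are the operators xs n ⊗ ys n. Distinct n give
    distinct exponents, as n |-> n^q is strictly increasing, so hypothesis
    [orth] applies to the terms of both series. *)
Lemma summable_orbits_schatten_tensor (x y : H) (xs ys : nat -> H) :
  uniformly_summable (fun r n => (0 < n <= r)%N)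
    (fun r n =>
       rnorm (iter (r ^ q - (r - n) ^ q)%N A x) `^ p
       * rnorm (iter (r ^ q - (r - n) ^ q)%N (adjoint T) y) `^ p) ->
  uniformly_summable (fun _ n => (0 < n)%N)
    (fun r n =>
       rnorm (xs ((n + r) ^ q - r ^ q)%N) `^ p
       * rnorm (ys ((n + r) ^ q - r ^ q)%N) `^ p) ->
  (forall m n : nat, m <> n ->
     [/\ inner (iter n A x) (iter m A x) = 0,
         inner (xs n) (xs m) = 0,
         inner (iter n (adjoint T) y) (iter m (adjoint T) y) = 0
       & inner (ys n) (ys m) = 0]) ->
  (forall n : nat,
     iter (n ^ q)%N A (xs (n ^ q)%N) = x /\
     iter (n ^ q)%N (adjoint T) (ys (n ^ q)%N) = y) ->
  (forall m n : nat, (n < m)%N ->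
     iter (n ^ q)%N A (xs (m ^ q)%N) = xs (m ^ q - n ^ q)%N /\
     iter (n ^ q)%N (adjoint T) (ys (m ^ q)%N) = ys (m ^ q - n ^ q)%N) ->
  good (schatten_tensor x y).
Proof.
move=> sum1 sum2 orth inv shift; exists (fun n => schatten_tensor (xs n) (ys n)); split.
- split=> [n|m n mn]; rewrite iter_two_sided_mul.
    by have [-> ->] := inv n.
  by have [-> ->] := shift m n mn.
- rewrite (_ : forward_orbit _ _ _ = fun r n => schatten_tensor
      (iter (r ^ q - (r - n) ^ q)%N A x) (iter (r ^ q - (r - n) ^ q)%N (adjoint T) y)).
    apply: small_tails_schatten_tensor sum1 => r m n; rewrite !unfold_in /= => mr nr mn.
    have ne : (r ^ q - (r - n) ^ q)%N <> (r ^ q - (r - m) ^ q)%N.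
      move: (mn); rewrite neq_ltn => /orP[lt|lt].
        have := ltn_exp2r (r - n) (r - m) q_gt0; have := leq_exp2r (r - m) r q_gt0; lia.
      have := ltn_exp2r (r - m) (r - n) q_gt0; have := leq_exp2r (r - n) r q_gt0; lia.
    by have [-> _ -> _] := orth _ _ ne.
  by apply/funext => r; apply/funext => n; rewrite /forward_orbit iter_two_sided_mul.
- apply: small_tails_schatten_tensor; last first.
    by move=> e e0; have [N NP] := sum2 e e0; exists N => r;
       under eq_eseriesl do rewrite andbT.
  move=> r m n _ _ mn.
  have ne : ((n + r) ^ q - r ^ q)%N <> ((m + r) ^ q - r ^ q)%N.
    move: (mn); rewrite neq_ltn => /orP[lt|lt].
      have := ltn_exp2r (m + r) (n + r) q_gt0; have := leq_exp2r r (m + r) q_gt0; lia.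
    have := ltn_exp2r (n + r) (m + r) q_gt0; have := leq_exp2r r (n + r) q_gt0; lia.
  by have [_ -> _ ->] := orth _ _ ne.
Qed.

Lemma summable_orbits_sum {I : Type} (s : seq I) (f : I -> schatten H p1) :
  (forall i, good (f i)) -> good (\sum_(i <- s) f i).
Proof.
move=> fg; elim/big_rec: _ => [|i x _]; first exact: summable_orbits0.
by move=> gx; apply: summable_orbitsD.
Qed.

Lemma summable_orbits_span (D1 D2 : set H) x y :
  (forall x y, D1 x -> D2 y -> good (schatten_tensor x y)) ->
  lin_span D1 x -> lin_span D2 y -> good (schatten_tensor x y).
Proof.
move=> Dg [m [c [u [Du ->]]]] [n [d [v [Dv ->]]]].
have gl i : good (schatten_tensor (u i) (\sum_j d j *: v j)).
  rewrite (big_morph _ (schatten_tensorDr _) (_ : _ = 0)).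
    by apply: summable_orbits_sum => j; rewrite schatten_tensorZr; apply/summable_orbitsZ/Dg.
  by apply: (addrI (schatten_tensor (u i) 0)); rewrite -schatten_tensorDr !addr0.
rewrite (big_morph (fun x => schatten_tensor x _)
  (fun a b => schatten_tensorDl a b _) (_ : _ = 0)).
  by apply: summable_orbits_sum => i; rewrite schatten_tensorZl; exact: summable_orbitsZ.
by apply: (addrI (schatten_tensor 0 (\sum_j d j *: v j))); rewrite -schatten_tensorDl !addr0.
Qed.

End TensorOrbits.

Theorem theorem4p3 (Rr : realType) (k : scalar_kind) (H : hilbertType Rr k)
    (q : nat) (p : Rr) (R T : clinear H H) (D1 D2 : set H)
    (H_separable : separable H) (q_gt0 : (0 < q)%N) (p_ge1 : 1 <= p)
    (D1_dense : dense (lin_span D1)) (D2_dense : dense (lin_span D2))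
    (hyp : forall x y : H, D1 x -> D2 y ->
      exists (xs ys : nat -> H),
      (xs 0%N = x /\ ys 0%N = y) /\
      (uniformly_summable (fun r n => (0 < n <= r)%N)
         (fun r n =>
            rnorm (iter (r ^ q - (r - n) ^ q)%N R x) `^ p
            * rnorm (iter (r ^ q - (r - n) ^ q)%N (adjoint T) y) `^ p) /\
       uniformly_summable (fun _ n => (0 < n)%N)
         (fun r n =>
            rnorm (xs ((n + r) ^ q - r ^ q)%N) `^ p
            * rnorm (ys ((n + r) ^ q - r ^ q)%N) `^ p)) /\
      (forall m n : nat, m <> n ->
         [/\ inner (iter n R x) (iter m R x) = 0,
             inner (xs n) (xs m) = 0,
             inner (iter n (adjoint T) y) (iter m (adjoint T) y) = 0
           & inner (ys n) (ys m) = 0]) /\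
      ((forall n : nat,
          iter (n ^ q)%N R (xs (n ^ q)%N) = x /\
          iter (n ^ q)%N (adjoint T) (ys (n ^ q)%N) = y) /\
       (forall m n : nat, (n < m)%N ->
          iter (n ^ q)%N R (xs (m ^ q)%N) = xs (m ^ q - n ^ q)%N /\
          iter (n ^ q)%N (adjoint T) (ys (m ^ q)%N) = ys (m ^ q - n ^ q)%N))) :
  q_frequently_hypercyclic q (two_sided_mul p_ge1 R T).
Proof.
have Dgood x y : D1 x -> D2 y ->
    summable_orbits (two_sided_mul p_ge1 R T) q (schatten_tensor p_ge1 x y).
  move=> Dx Dy; have [xs [ys [_ [[sum1 sum2] [orth [inv shift]]]]]] := hyp x y Dx Dy.
  exact: summable_orbits_schatten_tensor sum1 sum2 orth inv shift.
have [z1 [z1D z1d]] := separable_dense_span D1 H_separable D1_dense.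
have [z2 [z2D z2d]] := separable_dense_span D2 H_separable D2_dense.
pose code := seq ((nat * nat) * (nat * nat)).
pose Z (s : code) : schatten H p_ge1 :=
  \sum_(i <- s) schatten_tensor p_ge1 (z1 i.1) (z2 i.2).
(* The valuation of l.+1 takes every value for arbitrarily large l, so w runs
   infinitely often through each of the countably many sums Z s. *)
pose w l := Z (odflt [::] (unpickle (logn 2 l.+1))).
have [U hU] := @schatten_halving_base _ _ H _ p_ge1.
apply: (@q_frequent_hypercyclicity_criterion _ _ _ _ q q_gt0 U hU
          (@schatten_seq_complete _ _ _ _ _) w).
  move=> l; apply: summable_orbits_sum => i.
  exact: summable_orbits_span Dgood (z1D _) (z2D _).
move=> V openV [S VS] L.
have /schatten_nbhsP[e e0 eV] := open_nbhs_nbhs (conj openV VS).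
have [s sP] := sum_tensor_dense p_ge1 z1 z2 z1d z2d S e e0.
exists (2 ^ pickle s * L.*2.+1).-1%N.
  have := expn_gt0 2 (pickle s); move: (2 ^ _)%N => a /=; nia.
apply: eV; rewrite /w prednK ?muln_gt0 ?expn_gt0// logn2_odd pickleK /=.
by rewrite -schatten_normN ?(lt_le_trans ltr01 p_ge1)// opprB val_sum_schatten_tensor.
Qed.
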